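(* Let $n=2l+1$ with $l\ge 0$. (Direct problem.) Let $b_0,\dots,b_{n-1}\in\mathbb{R}\setminus\{0\}$ and let $J_n$ be the Schwarz matrix with entries $b_0,\dots,b_{n-1}$. The characteristic polynomial $p(z)=\det(zE_n-J_n)$ is almost generalized Hurwitz of type I if and only if $$b_0>0,\quad b_1b_2>0,\quad b_3b_4>0,\ \dots,\ b_{n-2}b_{n-1}>0$$ (that is, $b_0>0$ and $b_{2j-1}b_{2j}>0$ for $1\le j\le l$). In this case the order $\varkappa$ of $p$ (as an almost generalized Hurwitz polynomial) equals the number of negative terms in the sequence $$b_0b_1,\quad b_0b_1b_2b_3,\quad b_0b_1b_2b_3b_4b_5,\ \dots,\ b_0b_1\cdots b_{n-2}$$ (the products $\prod_{k=0}^{2i-1}b_k$, $i=1,\dots,l$). (Inverse problem.) Conversely, let $\lambda_1,\dots,\lambda_n$ be complex numbers such that the polynomial $p(z)=\prod_{k=1}^n(z-\lambda_k)$ is almost generalized Hurwitz of type I of order $\varkappa$ and $\Delta_j(p)\ne 0$ for $j=1,\dots,n$. Then there exists a unique Schwarz matrix $J_n$ with nonzero real entries $b_0,\dots,b_{n-1}$ satisfying $b_0>0$, $b_1b_2>0$, $b_3b_4>0$, $\dots$, $b_{n-2}b_{n-1}>0$, such that the number of negative terms in the sequence $b_0b_1,\ b_0b_1b_2b_3,\ \dots,\ b_0b_1\cdots b_{n-2}$ equals $\varkappa$, and $\sigma(J_n)=\{\lambda_1,\dots,\lambda_n\}$ (spectrum counted with multiplicities).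
   Context: The Schwarz matrix $J_n$ with entries $b_0,\dots,b_{n-1}\in\mathbb{R}\setminus\{0\}$ is the $n\times n$ tridiagonal matrix with $(1,1)$ entry $-b_0$, all other diagonal entries $0$, all superdiagonal entries $1$, and $(k+1,k)$ entry $-b_k$ for $1\le k\le n-1$. $E_n$ is the $n\times n$ identity matrix. Hurwitz determinants: for a monic real polynomial $p(z)=z^n+a_1z^{n-1}+\cdots+a_n$ put $a_0=1$ and $a_i=0$ for $i<0$ or $i>n$; then $\Delta_j(p)=\det\left[a_{2s-r}\right]_{r,s=1}^{j}$ ($r$ the row index, $s$ the column index), $j=1,\dots,n$. $[\alpha]$ is the largest integer not exceeding $\alpha$. Generalized Hurwitz polynomials: a real polynomial $f$ of degree $N$ is generalized Hurwitz of type I of order $\varkappa$, $1\le\varkappa\le\left[\frac{N+1}{2}\right]$, if it has exactly $\varkappa$ zeroes in the closed right half-plane, all of which are nonnegative and simple, $0\le\mu_1<\mu_2<\dots<\mu_\varkappa$, such that: $f(-\mu_i)\ne0$ for $i=2,\dots,\varkappa$, and $f(-\mu_1)\neq 0$ if $\mu_1>0$; $f$ has an odd number of zeroes, counting multiplicities, on each of the intervals $(-\mu_\varkappa,-\mu_{\varkappa-1}),\dots,(-\mu_3,-\mu_2),(-\mu_2,-\mu_1)$; the number of zeroes of $f$ on $(-\mu_1,0)$ (if any) is even, counting multiplicities; the other real zeroes lie on $(-\infty,-\mu_\varkappa)$, an odd number of them counting multiplicities if $N$ is even, and an even number if $N$ is odd; all nonreal zeroes (if any) lie in the open left half-plane.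 Almost generalized Hurwitz polynomials: a real polynomial $p(z)$ is almost generalized Hurwitz of type I of order $\varkappa\ge0$ if the polynomial $zp(z)$ is generalized Hurwitz of type I of order $\varkappa+1$; it is almost generalized Hurwitz of type I if it is so of some order. *)

(* Defs.v *)
From mathcomp Require Import all_boot all_order all_algebra.
From mathcomp Require Import reals.
From mathcomp Require Import polyorder polyrcf complex.

Set Implicit Arguments.
Unset Strict Implicit.
Unset Printing Implicit Defensive.

Import Order.TTheory GRing.Theory Num.Theory.

Local Open Scope ring_scope.

(* Rows and columns are numbered from 0, so the subdiagonal entry of row i
   (i >= 1) is - b_i. *)
Definition schwarz_mx (R : realType) (n : nat) (b : n.-tuple R) : 'M[R]_n :=
  \matrix_(i, j)
    if i == j :> nat then (if i == 0%N :> nat then - b`_0 else 0)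
    else if j == i.+1 :> nat then 1
    else if i == j.+1 :> nat then - b`_i
    else 0.

(* The coefficient a_i of p = z^n + a_1 z^(n-1) + ... + a_n, extended by 0
   outside 0 <= i <= n. *)
Definition acoef (R : realType) (p : {poly R}) (i : int) : R :=
  if i is Posz k then
    if (k <= (size p).-1)%N then p`_((size p).-1 - k)%N else 0
  else 0.

Definition hurwitz_det (R : realType) (p : {poly R}) (j : nat) : R :=
  \det (\matrix_(r < j, s < j) acoef p (s.+1.*2%:Z - r.+1%:Z)).

Definition poly_toC (R : realType) (f : {poly R}) : {poly R[i]} :=
  map_poly (real_complex R) f.

(* Number of zeros of f on the interval I, with multiplicities. *)
Definition nzeros (R : realType) (f : {poly R}) (I : interval R) : nat :=
  \sum_(x <- rootsR f | x \in I) \mu_x f.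

(* mu`_0 < ... < mu`_(kappa-1) are the zeros of f in the closed right
   half-plane.  Once they are described by ghI_rhp, every other real zero is
   negative, and ghI_nosym confines it to one of the intervals named in the
   last three clauses.  When mu`_0 = 0 the interval of ghI_inner is empty. *)
Record gen_hurwitzI_zeros (R : realType) (f : {poly R}) (kappa : nat)
    (mu : kappa.-tuple R) : Prop := GenHurwitzIZeros {
  ghI_ge0 : all (fun x => 0 <= x) mu;
  ghI_incr : sorted <%R mu;
  ghI_rhp : forall z : R[i], 0 <= complex.Re z ->
    root (poly_toC f) z <-> exists2 x, x \in mu & z = real_complex R x;
  ghI_simple : forall x, x \in mu -> \mu_x f = 1%N;
  ghI_nonreal : forall z : R[i], root (poly_toC f) z ->
    complex.Im z != 0 -> complex.Re z < 0;
  ghI_nosym : forall i, (0 < i < kappa)%N -> f.[- mu`_i] != 0;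
  ghI_nosym0 : 0 < mu`_0 -> f.[- mu`_0] != 0;
  ghI_between : forall i, (i.+1 < kappa)%N ->
    odd (nzeros f `](- mu`_i.+1), (- mu`_i)[);
  ghI_inner : ~~ odd (nzeros f `](- mu`_0), 0[);
  ghI_outer : odd (nzeros f `]-oo, (- mu`_kappa.-1)[) = ~~ odd (size f).-1
}.

Definition gen_hurwitzI (R : realType) (f : {poly R}) (kappa : nat) : Prop :=
  [/\ f != 0,
      (1 <= kappa <= ((size f).-1.+1)./2)%N
    & exists mu : kappa.-tuple R, gen_hurwitzI_zeros f mu].

Definition almost_gen_hurwitzI_order (R : realType) (p : {poly R})
    (kappa : nat) : Prop :=
  gen_hurwitzI ('X * p) kappa.+1.

Definition almost_gen_hurwitzI (R : realType) (p : {poly R}) : Prop :=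
  exists kappa, almost_gen_hurwitzI_order p kappa.

(* b_0 > 0 and b_1 b_2 > 0, ..., b_(n-2) b_(n-1) > 0, where n = 2 l + 1. *)
Definition pos_pairs (R : realType) (l : nat) (b : seq R) : Prop :=
  0 < b`_0 /\
  forall j, (1 <= j <= l)%N -> 0 < b`_(j.*2.-1) * b`_(j.*2).

(* Number of negative terms among b_0 b_1, ..., b_0 b_1 ... b_(2l-1). *)
Definition num_neg_prods (R : realType) (l : nat) (b : seq R) : nat :=
  count (fun i => \prod_(0 <= k < i.*2) b`_k < 0) (iota 1 l).

(* The spectrum of a real matrix in the complex plane, with algebraic
   multiplicities, is the list lam. *)
Definition has_spectrum (R : realType) (n : nat) (A : 'M[R]_n)
    (lam : seq R[i]) : Prop :=
  forall z : R[i],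
    \mu_z (char_poly (map_mx (real_complex R) A)) = count_mem z lam.

(* Main.v *)
(* Write p = A + b_0 B with A odd and B even.  The three-term recurrence of the
   tails of J gives the Christoffel-Darboux identity
     p(z)p(w) - p(-z)p(-w) = 2(z + w) sum_k beta_k T_k(z) T_k(w),
   with T_k monic of degree n-1-k and beta_k = b_0 ... b_k; the sign conditions
   say that beta_k > 0 for even k, and the order should be the number of
   negative beta_k with k odd.
   If p is almost generalized Hurwitz with kappa positive zeros, expanding the
   same kernel over the zeros of p (Hermite) bounds the number of negative
   beta_k by kappa.  On the other hand, right of each positive zero of p, and
   before the next one, A has a zero a with A'(a)p(a) >= 0; at these points the
   odd part of the kernel is diagonal and nonpositive, so at least kappa of the
   beta_k with k odd are negative.  Conversely, if beta_k > 0 for even k, the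
   even part of the kernel is positive definite, which confines the nonreal
   zeros to the left half-plane and gives p'(x)p(-x) > 0 at the positive zeros
   x; this inequality is equivalent to the parity conditions on the negative
   zeros.  For the inverse problem, the Routh algorithm recovers the b_k, one
   elimination step on the Hurwitz matrix for each. *)

Require Import Defs.
From mathcomp Require Import all_boot all_order all_algebra.
From mathcomp Require Import reals.
From mathcomp Require Import polyorder polyrcf complex.
From mathcomp Require Import ring zify.

Set Implicit Arguments.
Unset Strict Implicit.
Unset Printing Implicit Defensive.

Import Order.TTheory GRing.Theory Num.Theory.

Local Open Scope ring_scope.

(** * The characteristic polynomial and its three-term recurrence *)

(** With [s] the entries [b_1, b_2, ...], these are the [A] and [B] of [p = A + b_0 B]: the
    determinant of [zE - J] for [b_0 = 0], and the minor without the first row and column. *)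
Definition tail_pair (R : comNzRingType) (s : seq R) : {poly R} * {poly R} :=
  foldr (fun c AB => ('X * AB.1 + c *: AB.2, AB.1)) ('X, 1) s.

(** The corner entry [d] is free because deleting the first row and column replaces ['X + b_0] by
    ['X] there. *)
Definition tridiag_mx (R : comNzRingType) (m : nat) (d : {poly R})
    (s : seq R) : 'M[{poly R}]_m :=
  \matrix_(i, j)
    if i == j :> nat then (if i == 0%N :> nat then d else 'X)
    else if j == i.+1 :> nat then -1
    else if i == j.+1 :> nat then (s`_j)%:P
    else 0.

(** Expand along the first row, then expand the second minor along its first column. *)
Lemma det_tridiag_rec (R : comNzRingType) (m : nat) (d : {poly R}) (c : R)
    (s : seq R) :
  \det (tridiag_mx m.+2 d (c :: s)) =
    d * \det (tridiag_mx m.+1 'X s) + c *: \det (tridiag_mx m 'X (behead s)).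
Proof.
rewrite (expand_det_row _ ord0) !big_ord_recl big1 ?addr0; last first.
  by move=> i _; rewrite !mxE /= mul0r.
rewrite !mxE /= /cofactor /= mulN1r.
rewrite /bump /= !addn0 add0n expr0 expr1 mul1r mulN1r opprK; congr (_ * _ + _).
  congr (\det _); apply/matrixP => i j; rewrite !mxE /= /bump /= !add1n !eqSS.
  by case: i => [[|i] ?].
rewrite (expand_det_col _ ord0) big_ord_recl big1 ?addr0; last first.
  by move=> i _; rewrite !mxE /= mul0r.
rewrite !mxE /= /cofactor /= expr0 mul1r -mul_polyC; congr (_ * _).
congr (\det _); apply/matrixP => i j.
rewrite !mxE /= /bump /= !add1n !eqSS /=.
by case: s => [|x s]; case: i => [[|i] ?] //=; case: eqP => // _; case: ifP; rewrite ?nth_nil.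
Qed.

Lemma det_tridiag (R : comNzRingType) (s : seq R) (d : {poly R}) :
  \det (tridiag_mx (size s).+1 d s) =
    (tail_pair s).1 + (d - 'X) * (tail_pair s).2.
Proof.
(* The recursion reaches back two sizes, so the induction carries both determinants. *)
suff [-> _] : (\det (tridiag_mx (size s).+1 d s) =
    (tail_pair s).1 + (d - 'X) * (tail_pair s).2) /\
    \det (tridiag_mx (size s) 'X (behead s)) = (tail_pair s).2 by [].
elim: s d => [|c s IH] d.
  by rewrite det_mx11 !mxE /= det_mx00 mulr1 addrC subrK.
rewrite det_tridiag_rec (IH 'X).2 /= (IH 'X).1 subrr mul0r addr0.
by split=> //; rewrite -!mul_polyC; ring.
Qed.

Lemma char_poly_schwarz (R : realType) (n : nat) (b : n.+1.-tuple R) :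
  char_poly (schwarz_mx b) =
    (tail_pair (behead b)).1 + b`_0 *: (tail_pair (behead b)).2.
Proof.
have sb : size (behead b) = n by rewrite size_behead size_tuple.
transitivity (\det (tridiag_mx n.+1 ('X + (b`_0)%:P) (behead b))).
  congr (\det _); apply/matrixP => i j; rewrite !mxE nth_behead -!val_eqE /=.
  case: eqP => [_|_]; first by case: ifP; rewrite ?mulr1n ?polyCN ?opprK ?subr0.
  rewrite mulr0n sub0r; case: ifP => _; first by [].
  by case: eqP => [->|_]; rewrite ?polyCN ?opprK ?oppr0.
by have := det_tridiag (behead b) ('X + (b`_0)%:P); rewrite sb => ->; rewrite -mul_polyC; ring.
Qed.

Lemma tail_pair_size_monic (R : comNzRingType) (s : seq R) :
  [/\ size (tail_pair s).1 = (size s).+2, (tail_pair s).1 \is monic,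
      size (tail_pair s).2 = (size s).+1 & (tail_pair s).2 \is monic].
Proof.
elim: s => [|c s [sA mA sB mB]] /=.
  by rewrite size_polyX size_poly1 monicX monic1.
have sXA : size ('X * (tail_pair s).1) = (size s).+3.
  by rewrite -commr_polyX size_mulX ?sA // -size_poly_gt0 sA.
have lt_c : (size (c *: (tail_pair s).2)%R < size ('X * (tail_pair s).1)%R)%N.
  by rewrite sXA (leq_ltn_trans (size_scale_leq _ _)) // sB.
split=> //; first by rewrite size_polyDl.
by rewrite monicE lead_coefDl // -commr_polyX lead_coefMX -monicE.
Qed.

Lemma tail_pair_parity (R : comNzRingType) (s : seq R) (x : R) :
  (tail_pair s).1.[- x] = (-1) ^+ (size s).+1 * (tail_pair s).1.[x] /\
  (tail_pair s).2.[- x] = (-1) ^+ size s * (tail_pair s).2.[x].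
Proof.
elim: s => [|c s [IHA IHB]] /=; first by rewrite !hornerE; split; ring.
by rewrite !hornerE IHA IHB; split=> //; rewrite !exprS; ring.
Qed.

Lemma tail_pair_map (R S : comNzRingType) (f : {rmorphism R -> S})
    (s : seq R) :
  tail_pair (map f s) =
    (map_poly f (tail_pair s).1, map_poly f (tail_pair s).2).
Proof.
elim: s => [|c s IH] /=; first by rewrite map_polyX rmorph1.
by rewrite IH /= rmorphD rmorphM /= map_polyX map_polyZ.
Qed.

(** As the entries are nonzero, a common zero passes to the next shorter pair, and the last pair
    ends with the constant [1]. *)
Lemma tail_pair_coprime (R : idomainType) (s : seq R) (x : R) :
  (forall k, (k < size s)%N -> s`_k != 0) ->
  root (tail_pair s).1 x -> ~~ root (tail_pair s).2 x.
Proof.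
elim: s => [|c s IH] s0 /=; first by rewrite /root hornerC oner_eq0.
rewrite /root !hornerE => /eqP A0; apply/negP => /eqP B0.
move: A0; rewrite B0 mulr0 add0r => /eqP; rewrite mulf_eq0 (negPf (s0 0%N _)) //=.
by apply/negP/IH; [move=> k /(s0 k.+1) | apply/rootP].
Qed.

(** Entries are peeled off from the front: [B] is the next [A], and [A - 'X * B] is [c] times the
    next [B], which is monic, so [c] is a leading coefficient. *)
Lemma tail_pair_inj (R : idomainType) (s t : seq R) :
  (forall k, (k < size s)%N -> s`_k != 0) ->
  size s = size t -> tail_pair s = tail_pair t -> s = t.
Proof.
elim: s t => [|c s IH] [|d t] //= s0 [est] [+ eA]; rewrite eA => /addrI eB.
have [_ _ _ mBs] := tail_pair_size_monic s.
have [_ _ _ mBt] := tail_pair_size_monic t.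
have ecd : c = d.
  have := congr1 lead_coef eB.
  by rewrite !lead_coefZ (monicP mBs) (monicP mBt) !mulr1.
rewrite -ecd in eB *; congr cons; apply: IH => //.
  by move=> k /(s0 k.+1).
rewrite [LHS]surjective_pairing [RHS]surjective_pairing eA; congr pair.
apply: (@mulfI _ c%:P); first by rewrite polyC_eq0 (s0 0%N).
by rewrite !mul_polyC.
Qed.

(* Christoffel-Darboux formula for the three-term recurrence
   T_k = z T_(k+1) + s_k T_(k+2), where T_k = (tail_pair (drop k s)).2. *)
Lemma tail_pair_kernel (R : comNzRingType) (s : seq R) (x y : R) :
  (tail_pair s).1.[x] * (tail_pair s).2.[y] +
  (tail_pair s).2.[x] * (tail_pair s).1.[y] =
  (x + y) * \sum_(k < (size s).+1) (\prod_(j < k) s`_j) *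
     ((tail_pair (drop k s)).2.[x] * (tail_pair (drop k s)).2.[y]).
Proof.
elim: s => [|c s IH] /=.
  by rewrite big_ord1 big_ord0 /= !hornerE /= !mulr1.
rewrite big_ord_recl big_ord0 mul1r drop0 /=.
under eq_bigr => k _ do rewrite big_ord_recl /= -mulrA.
rewrite -mulr_sumr mulrDr [X in _ = _ + X]mulrCA -IH !(hornerD, hornerM, hornerX, hornerZ) /=; ring.
Qed.

(** The [T_k] are monic of degrees [size s, ..., 1, 0], so they span all polynomials of degree at
    most [size s]. *)
Lemma tail_pair_span (F : fieldType) (s : seq F) (L : {poly F} -> F) :
  (forall a p q, L (a *: p + q) = a * L p + L q) ->
  (forall k, (k < (size s).+1)%N -> L (tail_pair (drop k s)).2 = 0) ->
  forall q : {poly F}, (size q <= (size s).+1)%N -> L q = 0.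
Proof.
move=> linL L0; have L00 : L 0 = 0.
  by have := linL (-1) 0 0; rewrite scaler0 addr0 mulN1r addNr.
suff step d : (d <= (size s).+1)%N -> forall q : {poly F}, (size q <= d)%N -> L q = 0.
  by move=> q; apply: step.
elim: d => [|d IH] ds q sq.
  by move: sq; rewrite size_poly_leq0 => /eqP ->.
(* The index is chosen so that [T] has degree [d] and cancels the coefficient of that degree in
   [q]. *)
pose T := (tail_pair (drop (size s - d) s)).2.
have sd : size (drop (size s - d) s) = d by rewrite size_drop subKn.
have [_ _ sT mT] := tail_pair_size_monic (drop (size s - d) s).
rewrite sd -/T in sT mT.
have -> : q = q`_d *: T + (q - q`_d *: T) by rewrite addrC subrK.
rewrite linL L0 ?ltnS ?leq_subr // mulr0 add0r; apply: IH; first exact: ltnW.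
apply/leq_sizeP => j; rewrite leq_eqVlt => /orP[/eqP <-|dj].
  have Td : T`_d = 1 by have /monicP := mT; rewrite lead_coefE sT.
  by rewrite coefB coefZ Td mulr1 subrr.
rewrite coefB coefZ [T`_j]nth_default ?sT // mulr0 subr0.
by rewrite nth_default // (leq_trans sq dj).
Qed.

(** The functional [q |-> sum c_i q(x_i)] vanishes by [tail_pair_span]; test it on the polynomial
    that vanishes at every node except [x_i]. *)
Lemma tail_pair_unisolvent (F : fieldType) (s : seq F) (m : nat)
    (x c : 'I_m -> F) :
  injective x -> (m <= (size s).+1)%N ->
  (forall k, (k < (size s).+1)%N ->
     \sum_i c i * (tail_pair (drop k s)).2.[x i] = 0) ->
  forall i, c i = 0.
Proof.
move=> injx ms c0 i.
pose q := \prod_(j | j != i) ('X - (x j)%:P).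
have Lq : \sum_j c j * q.[x j] = 0.
  apply: (tail_pair_span (s := s) (L := fun q => \sum_j c j * q.[x j])) => //.
    move=> a p r; rewrite mulr_sumr -big_split; apply: eq_bigr => j _ /=.
    by rewrite hornerD hornerZ; ring.
  rewrite size_prod => [|j _]; last by rewrite polyXsubC_eq0.
  under eq_bigr => j _ do rewrite size_XsubC.
  rewrite sum_nat_const (cardC1 i) card_ord.
  by move: ms (ltn_ord i); lia.
have qi : q.[x i] != 0.
  rewrite horner_prod; apply/prodf_neq0 => j ji.
  by rewrite !hornerE subr_eq0 (inj_eq injx) eq_sym.
move: Lq; rewrite (bigD1 i) //= big1 ?addr0 => [/eqP|j ji].
  by rewrite mulf_eq0 (negPf qi) orbF => /eqP.
by rewrite /q (bigD1 j) //= hornerM hornerXsubC subrr mul0r mulr0.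
Qed.

(** * Hermitian forms and their signatures *)

(** The conditions are [#|P| + #|Q|] homogeneous linear equations in [m] unknowns. *)
Lemma kernel_vector (F : fieldType) (m p q : nat) (t : 'M[F]_(m, p))
    (a : 'M[F]_(m, q)) (P : pred 'I_p) (Q : pred 'I_q) :
  (#|P| + #|Q| < m)%N ->
  exists v : 'rV_m, [/\ v != 0, forall k, P k -> (v *m t) 0 k = 0
                      & forall k, Q k -> (v *m a) 0 k = 0].
Proof.
move=> ltm.
pose N := row_mx (\matrix_(i < m, k < #|P|) t i (enum_val k))
                 (\matrix_(i < m, k < #|Q|) a i (enum_val k)).
have : kermx N != 0.
  by rewrite -mxrank_eq0 mxrank_ker subn_eq0 -ltnNge (leq_ltn_trans (rank_leq_col _)).
case/rowV0Pn => v /sub_kermxP; rewrite mul_mx_row => /eqP.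
rewrite row_mx_eq0 => /andP[/eqP vt /eqP va] v0; exists v; split=> // k Pk.
  have := congr1 (fun M : 'rV_ _ => M 0 (enum_rank_in Pk k)) vt.
  rewrite !mxE => E; rewrite -[RHS]E; apply: eq_bigr => i _.
  by rewrite !mxE enum_rankK_in.
have := congr1 (fun M : 'rV_ _ => M 0 (enum_rank_in Pk k)) va.
rewrite !mxE => E; rewrite -[RHS]E; apply: eq_bigr => i _.
by rewrite !mxE enum_rankK_in.
Qed.

Lemma gram_form (C : numClosedFieldType) (m p : nat) (t : 'M[C]_(m, p))
    (beta : 'I_p -> C) (v : 'rV_m) :
  \sum_k beta k * ((v *m t) 0 k * ((v *m t) 0 k)^* ) =
  \sum_i \sum_j v 0 i * (v 0 j)^* * \sum_k beta k * (t i k * (t j k)^* ).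
Proof.
under [RHS]eq_bigr => i _.
  under eq_bigr => j _ do rewrite mulr_sumr.
  rewrite exchange_big; over.
rewrite [RHS]exchange_big; apply: eq_bigr => k _ /=.
rewrite mxE rmorph_sum mulr_suml mulr_sumr; apply: eq_bigr => i _ /=.
rewrite !mulr_sumr; apply: eq_bigr => j _ /=.
rewrite rmorphM /=; ring.
Qed.

(* On the common kernel of the columns with beta > 0 and with gamma < 0 the two
   sides of the identity have opposite signs, hence vanish. *)
Lemma signature_bound (C : numClosedFieldType) (m p q : nat)
    (t : 'M[C]_(m, p)) (a : 'M[C]_(m, q)) (beta : 'I_p -> C)
    (gamma : 'I_q -> C) :
  (forall k, beta k \is Num.real) -> (forall k, gamma k \is Num.real) ->
  (forall i j, \sum_k beta k * (t i k * (t j k)^* ) =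
               \sum_k gamma k * (a i k * (a j k)^* )) ->
  (forall v : 'rV_m,
     (forall k, beta k != 0 -> (v *m t) 0 k = 0) -> v = 0) ->
  (m <= #|[pred k | (0 < beta k)%R]| + #|[pred k | (gamma k < 0)%R]|)%N.
Proof.
move=> Rb Rg eqG injt; rewrite leqNgt; apply/negP.
case/(kernel_vector t a) => v [v0 vt va]; case/eqP: v0; apply: injt.
have eQ : \sum_k beta k * ((v *m t) 0 k * ((v *m t) 0 k)^* ) =
          \sum_k gamma k * ((v *m a) 0 k * ((v *m a) 0 k)^* ).
  by rewrite !gram_form; do 2!apply: eq_bigr => ? _; rewrite eqG.
have tle0 k : 0 <= - (beta k * ((v *m t) 0 k * ((v *m t) 0 k)^* )).
  rewrite -mulNr; have [b0|b0] := boolP (0 < beta k); first by rewrite vt // mul0r mulr0.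
  by rewrite mulr_ge0 ?mul_conjC_ge0 // oppr_ge0 real_leNgt ?real0.
have : \sum_k - (beta k * ((v *m t) 0 k * ((v *m t) 0 k)^* )) = 0.
  apply/le_anti/andP; split; last by apply: sumr_ge0.
  rewrite sumrN eQ oppr_le0; apply: sumr_ge0 => k _.
  have [g0|g0] := boolP (gamma k < 0); first by rewrite va // mul0r mulr0.
  by rewrite mulr_ge0 ?mul_conjC_ge0 // real_leNgt ?real0.
move/eqP; rewrite psumr_eq0 // => /allP t0 k b0.
have /eqP := t0 k (mem_index_enum k).
by move/eqP; rewrite oppr_eq0 mulf_eq0 (negPf b0) mul_conjC_eq0 => /eqP.
Qed.

(* Telescopes prod (z - x) (w - x^* ) - prod (z + x^* ) (w + x):
   each factor contributes - (z + w) (x + x^* ). *)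
Fixpoint hermite_vec (C : numClosedFieldType) (r : seq C) (z : C) : seq C :=
  if r is x :: r' then
    \prod_(y <- r') (z - y) :: [seq (z + x^* ) * g | g <- hermite_vec r' z]
  else [::].

Lemma size_hermite_vec (C : numClosedFieldType) (r : seq C) (z : C) : size (hermite_vec r z) = size r.
Proof. by elim: r => //= x r IH; rewrite size_map IH. Qed.

(** Hermite's expansion: each zero is weighted by twice its real part, so the signs of the weights
    tell on which side of the imaginary axis the zeros lie. *)
Lemma hermite_vec_kernel (C : numClosedFieldType) (r : seq C) (z w : C) : w \is Num.real ->
  \prod_(x <- r) (z - x) * (\prod_(x <- r) (w - x))^*  -
  \prod_(x <- r) (z + x^* ) * (\prod_(x <- r) (w + x^* ))^*  =
  - (z + w) * \sum_(k < size r) (r`_k + (r`_k)^* ) *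
     ((hermite_vec r z)`_k * ((hermite_vec r w)`_k)^* ).
Proof.
move=> Rw; elim: r => [|x r IH].
  by rewrite !big_nil big_ord0 conjC1 mulr1 subrr mulr0.
rewrite !big_cons big_ord_recl /= !rmorphM !rmorphB !rmorphD /=.
rewrite conjCK (CrealP Rw).
rewrite [X in _ = _ * (_ + X)](_ : _ = ((z + x^* ) * (w + x)) *
    \sum_(k < size r) (r`_k + (r`_k)^* ) *
       ((hermite_vec r z)`_k * ((hermite_vec r w)`_k)^* )); last first.
  rewrite mulr_sumr; apply: eq_bigr => k _.
  rewrite add0n !(nth_map 0) ?size_hermite_vec //.
  by rewrite rmorphM rmorphD /= conjCK (CrealP Rw); ring.
rewrite mulrDr [X in _ = _ + X]mulrCA -IH; ring.
Qed.

(** * Counting real zeros and signs *)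

Lemma mem_rootsR (R : rcfType) (p : {poly R}) (x : R) :
  p != 0 -> (x \in rootsR p) = root p x.
Proof. by move=> p0; rewrite -(roots_on_rootsR p0) in_itv. Qed.

(** Further points of [s] have multiplicity 0; this lets the counts for [p] and for a multiple of
    [p] run over one common list. *)
Lemma nzeros_sub (R : realType) (p : {poly R}) (I : interval R) (s : seq R) :
  p != 0 -> uniq s -> {subset rootsR p <= s} ->
  nzeros p I = (\sum_(x <- s | x \in I) \mu_x p)%N.
Proof.
move=> p0 us sub; rewrite /nzeros [RHS](bigID (mem (rootsR p))) /=.
rewrite [X in (_ + X)%N]big1 ?addn0; last first.
  by move=> x /andP[_]; rewrite mem_rootsR // => /muNroot.
under [RHS]eq_bigl => x do rewrite andbC.
rewrite -[RHS]big_filter_cond; apply: perm_big; apply: uniq_perm.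
- exact: uniq_roots.
- exact: filter_uniq.
- by move=> x; rewrite mem_filter; case: (boolP (x \in rootsR p)) => // /sub ->.
Qed.

Lemma nzeros_XsubC_mul (R : realType) (p : {poly R}) (a : R)
    (I : interval R) :
  p != 0 -> nzeros (('X - a%:P) * p) I = ((a \in I) + nzeros p I)%N.
Proof.
move=> p0; have p1 : ('X - a%:P) * p != 0 by rewrite mulf_neq0 ?polyXsubC_eq0.
pose s := undup (a :: rootsR p).
have us : uniq s by apply: undup_uniq.
rewrite (nzeros_sub I p1 us) ?(nzeros_sub I p0 us); last 2 first.
- by move=> x; rewrite mem_undup in_cons orbC => ->.
- by move=> x; rewrite mem_rootsR // mem_undup in_cons rootM root_XsubC mem_rootsR.
under eq_bigr => x _ do rewrite mu_mul //.
rewrite big_split /=; congr (_ + _)%N.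
rewrite big_mkcond (bigD1_seq a) //=; last by rewrite mem_undup mem_head.
rewrite mu_XsubC big1 ?addn0; first by case: (a \in I).
move=> x xa; case: ifP => // _; rewrite muNroot // root_XsubC //.
Qed.

(** Real zeros are split off one at a time, so statements on signs and counts reduce to the effect
    of one linear factor. *)
Lemma monic_root_ind (R : realType) (P : {poly R} -> Prop) :
  (forall p, p \is monic -> (forall x, ~~ root p x) -> P p) ->
  (forall p a, p \is monic -> P p -> P (('X - a%:P) * p)) ->
  forall p, p \is monic -> P p.
Proof.
move=> P0 PX p; have [m] := ubnP (size p).
elim: m p => // m IH p sp mp.
have p0 := monic_neq0 mp.
case E : (rootsR p) => [|a s].
  by apply: P0 => // x; rewrite -mem_rootsR // E.
have : root p a by rewrite -mem_rootsR // E mem_head.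
case/factor_theorem => q Ep.
have mq : q \is monic by move: mp; rewrite Ep monicMr ?monicXsubC.
rewrite Ep mulrC; apply: PX => //; apply: IH => //.
by move: sp; rewrite Ep size_Mmonic ?monic_neq0 ?monicXsubC // size_XsubC addn2.
Qed.

Lemma nzeros_noroot (R : realType) (p : {poly R}) (I : interval R) :
  p != 0 -> (forall x, ~~ root p x) -> nzeros p I = 0%N.
Proof.
move=> p0 p1; rewrite /nzeros big1_seq // => x /andP[_].
by rewrite mem_rootsR // (negPf (p1 x)).
Qed.

(** A monic polynomial without real zeros is positive, and a factor ['X - a] is negative at [v]
    exactly when [a > v]. *)
Lemma sgr_nzeros_gt (R : realType) (p : {poly R}) (v : R) :
  p \is monic -> ~~ root p v ->
  Num.sg p.[v] = (-1) ^+ nzeros p `]v, +oo[.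
Proof.
move=> mp; elim/monic_root_ind: mp => {}p => [mp p0 _|a mp IH].
  rewrite nzeros_noroot ?monic_neq0 // (sgp_pinftyP (x := v)) => [|x _|] //.
    by rewrite /sgp_pinfty (monicP mp) sgr1.
  by rewrite in_itv /= lexx.
rewrite rootM negb_or root_XsubC => /andP[va /IH pv].
rewrite hornerM sgrM pv nzeros_XsubC_mul ?monic_neq0 // exprD hornerXsubC.
rewrite in_itv /= andbT; congr (_ * _).
have [av|av|av] := ltrgtP a v; last by rewrite av eqxx in va.
  by rewrite gtr0_sg ?subr_gt0.
by rewrite ltr0_sg ?subr_lt0.
Qed.

Lemma sgr_nzeros_lt (R : realType) (p : {poly R}) (v : R) :
  p \is monic -> ~~ root p v ->
  Num.sg p.[v] = (-1) ^+ ((size p).-1 + nzeros p `]-oo, v[).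
Proof.
move=> mp; elim/monic_root_ind: mp => {}p => [mp p0 _|a mp IH].
  rewrite nzeros_noroot ?monic_neq0 // (sgp_minftyP (x := v)) => [|x _|] //.
    by rewrite /sgp_minfty (monicP mp) mulr1 addn0 sgrX sgrN1.
  by rewrite in_itv /= lexx.
rewrite rootM negb_or root_XsubC => /andP[va /IH pv].
rewrite hornerM sgrM pv nzeros_XsubC_mul ?monic_neq0 // hornerXsubC.
have -> : (size (('X - a%:P) * p)).-1 = (size p).-1.+1.
  rewrite size_monicM ?monicXsubC ?monic_neq0 // size_XsubC.
  by rewrite add2n /= prednK // size_poly_gt0 monic_neq0.
rewrite in_itv /= addSn [X in _ ^+ X.+1]addnCA exprS [in RHS]exprD mulrA; congr (_ * _).
have [av|av|av] := ltrgtP a v; last by rewrite av eqxx in va.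
  by rewrite gtr0_sg ?subr_gt0 // expr1 mulrNN mulr1.
by rewrite ltr0_sg ?subr_lt0 // expr0 mulr1.
Qed.

Lemma mu_eq1 (R : rcfType) (p : {poly R}) (x : R) :
  p != 0 -> root p x -> (\mu_x p == 1%N) = (p^`().[x] != 0).
Proof.
move=> p0 /factor_theorem[q Ep]; rewrite {}Ep in p0 *.
have q0 : q != 0 by apply: contraNneq p0 => ->; rewrite mul0r.
rewrite mu_mul // mu_XsubC addn1 eqSS derivM derivXsubC !hornerE subrr mulr0 add0r.
by rewrite -leqn0 leqNgt mu_gt0.
Qed.

(** Write [p = q * ('X - x)]; then [p'(x) = q(x)], and the split-off zero sits at the excluded
    endpoint. *)
Lemma sgr_deriv_nzeros (R : realType) (p : {poly R}) (x : R) :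
  p \is monic -> root p x -> p^`().[x] != 0 ->
  Num.sg p^`().[x] = (-1) ^+ nzeros p `]x, +oo[.
Proof.
move=> mp /factor_theorem[q Ep]; rewrite {}Ep mulrC in mp *.
have mq : q \is monic by move: mp; rewrite mulrC monicMr ?monicXsubC.
rewrite derivM derivXsubC mul1r hornerD hornerM hornerXsubC subrr mul0r addr0.
move=> qx; rewrite sgr_nzeros_gt ?nzeros_XsubC_mul ?monic_neq0 //.
by rewrite in_itv /= ltxx.
Qed.

Lemma nzeros_split (R : realType) (p : {poly R}) (a b : R) :
  p \is monic -> a < b -> ~~ root p a ->
  nzeros p `]-oo, b[ = (nzeros p `]-oo, a[ + nzeros p `]a, b[)%N.
Proof.
move=> mp lab; elim/monic_root_ind: mp => {}p => [mp p0 _|c mp IH].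
  by rewrite !nzeros_noroot ?monic_neq0.
rewrite rootM negb_or root_XsubC => /andP[va /IH pv].
rewrite !nzeros_XsubC_mul ?monic_neq0 // pv !in_itv /= addnACA; congr (_ + _)%N.
have [ca|ca|ca] := ltrgtP c a; last by rewrite ca eqxx in va.
  by rewrite (lt_trans ca lab).
by [].
Qed.

Lemma nzeros_simple (R : realType) (p : {poly R}) (mu : seq R)
    (I : interval R) :
  p != 0 -> uniq mu -> {in I, forall x, root p x = (x \in mu)} ->
  {in mu, forall x, \mu_x p = 1%N} -> nzeros p I = count (mem I) mu.
Proof.
move=> p0 us rp m1; rewrite /nzeros -big_filter.
rewrite (perm_big [seq x <- mu | x \in I]) /=; last first.
  apply: uniq_perm; rewrite ?filter_uniq ?uniq_roots // => x.
  rewrite !mem_filter; case: (boolP (x \in I)) => //= xI.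
  by rewrite mem_rootsR // rp.
rewrite big_filter big_seq_cond (eq_bigr (fun=> 1%N)); last first.
  by move=> x /andP[/m1].
by rewrite -big_seq_cond sum1_count.
Qed.

Lemma count_gt_nth (R : realType) (mu : seq R) (i : nat) :
  sorted <%R mu -> (i < size mu)%N ->
  count (fun x => mu`_i < x) mu = (size mu - i.+1)%N.
Proof.
move=> smu im; rewrite -(count_predC (fun x => x <= mu`_i) mu).
rewrite count_le_nth // addKn; apply: eq_count => x /=.
by rewrite -ltNge.
Qed.

(** Between [E k] and [E j] lie [k - j] increments, and the added [k - j] compensates the parity of
    each odd one. *)
Lemma parity_chain (E z : nat -> nat) (k : nat) :
  (forall j, (j < k)%N -> E j = (E j.+1 + z j)%N) ->
  (forall j, (j <= k)%N -> odd (E j + (k - j))) <->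
  (odd (E k) /\ forall j, (j < k)%N -> odd (z j)).
Proof.
move=> EE; split=> [oE|[oE oz] j].
  split=> [|j jk]; first by have := oE k (leqnn k); rewrite subnn addn0.
  by have := oE j (ltnW jk); have := oE j.+1 jk; rewrite (EE j jk); lia.
move=> jk; rewrite -(subKn jk); move: (leq_subr j k); elim: (k - j)%N => [|m IH] mk.
  by rewrite subn0 subnn addn0.
have := IH (ltnW mk); have : odd (z (k - m.+1)%N) by apply: oz; lia.
rewrite (EE (k - m.+1)%N); last by lia.
have -> : (k - m.+1).+1 = (k - m)%N by lia.
by lia.
Qed.

(** * Parity conditions as the inequality p'(x) p(-x) > 0 *)

(** The zero 0 is excluded on purpose: in ['X * p] it is supplied by the factor ['X]. *)
Definition rhp_roots (R : realType) (p : {poly R}) (mu : seq R) : Prop :=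
  [/\ sorted <%R mu, all (fun x => 0 < x) mu
    & forall z : R[i], 0 <= complex.Re z ->
        root (poly_toC p) z <-> exists2 x, x \in mu & z = real_complex R x].

Lemma root_toC (R : realType) (p : {poly R}) (x : R) :
  root (poly_toC p) (real_complex R x) = root p x.
Proof. exact: fmorph_root. Qed.

Lemma rhp_roots_real (R : realType) (p : {poly R}) (mu : seq R) (x : R) :
  rhp_roots p mu -> 0 <= x -> root p x = (x \in mu).
Proof.
move=> [_ _ rp] x0; rewrite -root_toC; apply/idP/idP.
  by move/(rp (real_complex R x) x0) => [y ymu [->]].
by move=> xmu; apply/(rp (real_complex R x)) => //; exists x.
Qed.

Lemma rhp_roots_root0 (R : realType) (p : {poly R}) (mu : seq R) :
  rhp_roots p mu -> ~~ root p 0.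
Proof.
move=> rp; rewrite (rhp_roots_real rp) //; case: rp => _ /allP mu0 _.
by apply/negP => /mu0; rewrite ltxx.
Qed.

Lemma sgr_mul_gt0 (R : realDomainType) (x y : R) :
  (0 < x * y) = (Num.sg x * Num.sg y == 1).
Proof. by rewrite -sgrM sgr_cp0. Qed.

(** The sign of [p'(x)] counts the zeros right of [x], that of [p(-x)] the zeros left of [-x], up to
    the odd degree. Prefixing 0 to [mu] shifts the indices by one. *)
Lemma reflection_parity (R : realType) (p : {poly R}) (mu : seq R) :
  p \is monic -> ~~ odd (size p) -> rhp_roots p mu ->
  {in mu, forall x, \mu_x p = 1%N} -> {in mu, forall x, ~~ root p (- x)} ->
  {in mu, forall x, 0 < p^`().[x] * p.[- x]} <->
  (forall j, (j <= size mu)%N ->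
     odd (nzeros p `]-oo, (- (0 :: mu)`_j)[ + (size mu - j))).
Proof.
move=> mp op rp m1 rN; have p0 := monic_neq0 mp.
have [smu /allP mu0 _] := rp; have umu := lt_sorted_uniq smu.
have odeg : odd (size p).-1.
  by case E : (size p) op => [|m] //=; [move: p0; rewrite -size_poly_gt0 E | rewrite negbK].
have N11 : (-1 == 1 :> R) = false by rewrite lt_eqF // (lt_trans (ltrN10 _)) ?ltr01.
have Ngt x : 0 <= x -> nzeros p `]x, +oo[ = count (fun y => x < y) mu.
  move=> x0; rewrite (nzeros_simple p0 umu _ m1).
    by apply: eq_count => y; rewrite /= in_itv /= andbT.
  move=> y; rewrite in_itv /= andbT => xy.
  by apply: (rhp_roots_real rp); apply/ltW/(le_lt_trans x0).
have key j : (j < size mu)%N ->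
    (0 < p^`().[mu`_j] * p.[- mu`_j]) =
    odd (nzeros p `]-oo, (- mu`_j)[ + (size mu - j.+1)).
  move=> jm; have jmu := mem_nth 0 jm; have j0 := ltW (mu0 _ jmu).
  have rj : root p mu`_j by rewrite (rhp_roots_real rp).
  rewrite sgr_mul_gt0 sgr_deriv_nzeros //; last by rewrite -mu_eq1 ?m1.
  rewrite sgr_nzeros_lt ?rN // Ngt // count_gt_nth // -exprD.
  rewrite -signr_odd oddD oddD odeg oddD [in RHS]addbC.
  by case: (odd _) => /=; case: (odd _) => /=; rewrite ?expr0 ?expr1 ?eqxx ?N11.
split=> [S [|j]|S x xmu].
(* The added point 0: compare the two expressions of the sign of [p(0)], by the zeros on its right
   and by those on its left. *)
- move=> _; rewrite /= oppr0 subn0.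
  have := sgr_nzeros_lt mp (rhp_roots_root0 rp).
  rewrite (sgr_nzeros_gt mp (rhp_roots_root0 rp)) Ngt // => /eqP.
  rewrite (eq_in_count (a2 := predT)) ?count_predT; last by move=> x /mu0 ->.
  rewrite -signr_odd -[_ ^+ (_ + _)]signr_odd (inj_eq (@signr_inj _)) oddD odeg oddD.
  by case: (odd _); case: (odd _).
- by move=> jm; rewrite -key //; apply: S; apply: mem_nth.
have jm : (index x mu < size mu)%N by rewrite index_mem.
by rewrite -(nth_index 0 xmu) key //; have := S (index x mu).+1 jm.
Qed.

Lemma nzerosXM (R : realType) (p : {poly R}) (I : interval R) :
  p != 0 -> 0 \notin I -> nzeros ('X * p) I = nzeros p I.
Proof.
move=> p0 I0; have -> : 'X * p = ('X - 0%:P) * p by rewrite polyC0 subr0.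
by rewrite nzeros_XsubC_mul // (negPf I0).
Qed.

Lemma root_toC_XM (R : realType) (p : {poly R}) (z : R[i]) :
  root (poly_toC ('X * p)) z = (z == 0) || root (poly_toC p) z.
Proof. by rewrite /poly_toC rmorphM /= map_polyX rootM rootX. Qed.

Lemma real_complex_inj (R : rcfType) : injective (real_complex R).
Proof. by move=> x y []. Qed.

(** Passes from counts on left rays to counts on the gaps between reflected zeros; a ray splits
    without loss because its cut point is not a zero. *)
Lemma between_parity (R : realType) (p : {poly R}) (mu : seq R) :
  p \is monic -> rhp_roots p mu -> {in mu, forall x, ~~ root p (- x)} ->
  (forall j, (j <= size mu)%N ->
     odd (nzeros p `]-oo, (- (0 :: mu)`_j)[ + (size mu - j))) <->
  (odd (nzeros p `]-oo, (- (0 :: mu)`_(size mu))[) /\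
   forall j, (j < size mu)%N ->
     odd (nzeros p `](- (0 :: mu)`_j.+1), (- (0 :: mu)`_j)[)).
Proof.
move=> mp [smu /allP mu0 _] rN.
apply: (parity_chain (E := fun j => nzeros p `]-oo, (- (0 :: mu)`_j)[)
  (z := fun j => nzeros p `](- (0 :: mu)`_j.+1), (- (0 :: mu)`_j)[)) => j jm.
apply: nzeros_split => //; last by apply: rN; apply: mem_nth.
rewrite ltrN2; case: j jm => [|j] jm /=; first by apply: mu0; apply: mem_nth.
by rewrite (lt_sorted_ltn_nth 0) ?inE // ltnW.
Qed.

(** In the closed right half-plane ['X * p] has the zero 0 and the zeros of [p], so order [k.+1]
    means [k] positive zeros of [p]. Its degree is even, so the outer ray carries an odd count, as
    [between_parity] requires. *)
Lemma almost_gen_hurwitzI_orderP (R : realType) (p : {poly R}) (k : nat) :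
  p \is monic -> ~~ odd (size p) ->
  almost_gen_hurwitzI_order p k <->
  (k < (size p)./2)%N /\
  exists mu, [/\ size mu = k, rhp_roots p mu
               & {in mu, forall x, 0 < p^`().[x] * p.[- x]}].
Proof.
move=> mp op; have p0 := monic_neq0 mp.
have X0 : ('X : {poly R}) != 0 by rewrite polyX_eq0.
have szX : size ('X * p) = (size p).+1 by rewrite -commr_polyX size_mulX.
have muX x : \mu_x ('X * p) = ((x == 0%R) + \mu_x p)%N.
  rewrite mu_mul ?mulf_neq0 //; have -> : 'X = 'X - 0%:P :> {poly R} by rewrite polyC0 subr0.
  have [->|x0] := eqVneq x 0; first by rewrite mu_XsubC.
  by rewrite muNroot // root_XsubC.
have nth0_ge0 (mu : seq R) j : all (fun x => 0 < x) mu -> 0 <= (0 :: mu)`_j.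
  move=> /allP mu0; case: j => [|j] //=.
  have [jm|jm] := ltnP j (size mu); first by apply/ltW/mu0/mem_nth.
  by rewrite nth_default.
split.
  case=> _; rewrite szX /= => km [mu' [ge0 srt rhp m1 _ nosym _ btw _ out]].
  split; first by move: km; have := odd_double_half (size p); lia.
  case: mu' ge0 srt rhp m1 nosym btw out => [[|x mu] //= smu] /andP[x0 ge0] srt rhp m1 nosym btw out.
  have [esm] := eqP smu.
  (* 0 is a zero of ['X * p], hence listed, and the head of the list is the least nonnegative
     zero. *)
  have ex0 : x = 0.
    have [] : exists2 y, y \in x :: mu & 0 = real_complex R y.
      by apply/rhp => //; rewrite root_toC_XM eqxx.
    move=> y; rewrite in_cons => /orP[/eqP -> []//|ymu [y0]].
    have := order_path_min lt_trans srt => /allP/(_ y ymu).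
    by rewrite -y0 ltNge x0.
  (* 0 is a simple zero of ['X * p], and ['X] already accounts for it. *)
  subst x; have pr0 : ~~ root p 0.
    have := m1 0; rewrite mem_head muX eqxx => /(_ isT) [] /eqP.
    by rewrite -leqn0 leqNgt mu_gt0.
  have mu0 : all (fun x => 0 < x) mu by apply: order_path_min lt_trans srt.
  have smu' : sorted <%R mu by apply: path_sorted srt.
  have rp : rhp_roots p mu.
    split=> // z z0; split=> [rz|[y ymu ez]].
      have [] : exists2 y, y \in 0 :: mu & z = real_complex R y.
        by apply/rhp => //; rewrite root_toC_XM rz orbT.
      move=> y; rewrite in_cons => /orP[/eqP -> ez|ymu ez]; last by exists y.
      by move: rz; rewrite ez root_toC (negPf pr0).
    have : root (poly_toC ('X * p)) z by apply/rhp => //; exists y; rewrite // in_cons ymu orbT.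
    rewrite root_toC_XM => /orP[/eqP z00|//].
    move: ez (allP mu0 y ymu); rewrite z00 => -[<-]; by rewrite ltxx.
  have m1' : {in mu, forall x, \mu_x p = 1%N}.
    move=> y ymu; have := m1 y; rewrite in_cons ymu orbT muX => /(_ isT).
    by rewrite gt_eqF ?(allP mu0).
  have rN : {in mu, forall x, ~~ root p (- x)}.
    move=> y ymu; have := nosym (index y mu).+1.
    rewrite /= ltnS -esm index_mem ymu => /(_ isT).
    by rewrite /= nth_index // hornerM mulf_eq0 negb_or => /andP[].
  exists mu; split=> //.
  apply/(reflection_parity mp op rp m1' rN)/(between_parity mp rp rN).
  split.
    move: out; rewrite szX /= op esm nzerosXM // in_itv /=.
    by rewrite oppr_gt0 -leNgt nth0_ge0.
  move=> j jm; have := btw j; rewrite ltnS -esm jm => /(_ isT).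
  rewrite nzerosXM // in_itv /=; apply/negP => /andP[_].
  by rewrite oppr_gt0 ltNge nth0_ge0.
case=> kp [mu [esm rp S]]; have [smu mu0 rhp] := rp.
have m1 : {in mu, forall x, \mu_x p = 1%N}.
  move=> x xmu; apply/eqP; rewrite mu_eq1 //.
    by apply: contraTneq (S x xmu) => ->; rewrite mul0r ltxx.
  by rewrite (rhp_roots_real rp) // ltW // (allP mu0).
have rN : {in mu, forall x, ~~ root p (- x)}.
  move=> x xmu; rewrite /root.
  by apply: contraTneq (S x xmu) => ->; rewrite mulr0 ltxx.
have /(between_parity mp rp rN)[out btw] :=
  (reflection_parity mp op rp m1 rN).1 S.
have pr0 := rhp_roots_root0 rp.
have smu' : size (0 :: mu) == k.+1 by rewrite /= esm.
split; first by rewrite mulf_neq0.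
  by rewrite szX /= uphalf_half (negPf op).
exists (Tuple smu'); split=> /=.
- by rewrite lexx; apply/allP => x /(allP mu0)/ltW.
- by rewrite path_min_sorted.
- move=> z z0; rewrite root_toC_XM; split=> [/orP[/eqP->|/(rhp z z0)[x xmu ->]]|].
  + by exists 0; rewrite ?mem_head.
  + by exists x; rewrite // in_cons xmu orbT.
  move=> [x]; rewrite in_cons => /orP[/eqP ->|xmu] ->; first by rewrite eqxx.
  by rewrite root_toC (rhp_roots_real rp) ?xmu ?orbT // ltW // (allP mu0).
- move=> x; rewrite in_cons muX => /orP[/eqP ->|xmu].
    by rewrite eqxx muNroot.
  by rewrite m1 // gt_eqF // (allP mu0).
- move=> z; rewrite root_toC_XM => rz Iz; rewrite ltNge; apply/negP => z0.
  case/orP: rz => [/eqP ez|/(rhp z z0)[x _ ez]].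
    by rewrite ez eqxx in Iz.
  by rewrite ez eqxx in Iz.
- case=> [|i] //=; rewrite ltnS -esm => im; have xmu := mem_nth 0 im.
  rewrite hornerM mulf_neq0 //; last exact: rN.
  by rewrite hornerX oppr_eq0 gt_eqF // (allP mu0).
- by rewrite ltxx.
- move=> j; rewrite ltnS -esm => jm; rewrite nzerosXM ?btw // in_itv /=.
  by apply/negP => /andP[_]; rewrite oppr_gt0 ltNge nth0_ge0.
(* The least zero is 0, so this interval is empty. *)
- rewrite oppr0 /nzeros big1 // => x; rewrite in_itv /=.
  by case: ltgtP.
by rewrite szX /= op nzerosXM -?esm // in_itv /= oppr_gt0 -leNgt nth0_ge0.
Qed.

(** * At most as many negative weights as positive zeros *)

(** The weight [beta_k = b_0 ... b_k]: [s] starts at [b_1], so there are [k + 1] factors. *)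
Definition prefix_prod (R : comNzRingType) (b0 : R) (s : seq R) (k : nat) : R :=
  b0 * \prod_(j < k) s`_j.

Lemma prefix_prod_neq0 (R : idomainType) (b0 : R) (s : seq R) (k : nat) :
  b0 != 0 -> (forall j, (j < size s)%N -> s`_j != 0) ->
  (k < (size s).+1)%N -> prefix_prod b0 s k != 0.
Proof.
move=> b00 s0 ks; rewrite mulf_neq0 //; apply/prodf_neq0 => j _.
by apply: s0; apply: leq_trans (ltn_ord j) _.
Qed.

Lemma tail_sum_monic (R : comNzRingType) (b0 : R) (s : seq R) :
  (tail_pair s).1 + b0 *: (tail_pair s).2 \is monic /\
  size ((tail_pair s).1 + b0 *: (tail_pair s).2) = (size s).+2.
Proof.
have [sA mA sB _] := tail_pair_size_monic s.
have lt_c : (size (b0 *: (tail_pair s).2)%R < size (tail_pair s).1)%N.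
  by rewrite sA (leq_ltn_trans (size_scale_leq _ _)) // sB.
by rewrite monicE lead_coefDl ?size_polyDl // -monicE.
Qed.

(** For even [size s], [A] is odd and [B] is even, so only [2 b_0 (A(x) B(y) + B(x) A(y))] survives,
    and [tail_pair_kernel] applies. *)
Lemma tail_sum_kernel (R : comNzRingType) (b0 x y : R) (s : seq R) :
  ~~ odd (size s) ->
  let p := (tail_pair s).1 + b0 *: (tail_pair s).2 in
  p.[x] * p.[y] - p.[- x] * p.[- y] =
  2 * (x + y) * \sum_(k < (size s).+1) prefix_prod b0 s k *
     ((tail_pair (drop k s)).2.[x] * (tail_pair (drop k s)).2.[y]).
Proof.
move=> es p; under eq_bigr => k _ do rewrite /prefix_prod -mulrA.
rewrite -mulr_sumr -!mulrA [(x + y) * _]mulrCA -tail_pair_kernel.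
have [xA xB] := tail_pair_parity s x; have [yA yB] := tail_pair_parity s y.
rewrite /p !hornerD !hornerZ xA xB yA yB exprS -signr_odd (negPf es) expr0; ring.
Qed.

Lemma gt0_addC (R : rcfType) (z : R[i]) : (0 < z + z^* ) = (0 < complex.Re z).
Proof.
case: z => a b; rewrite ltcE /= subrr eqxx /=.
by rewrite -mulr2n pmulrn_lgt0.
Qed.

Lemma count_root_le1 (F : fieldType) (r : seq F) (z : F) :
  (\prod_(x <- r) ('X - x%:P))^`().[z] != 0 -> (count_mem z r <= 1)%N.
Proof.
move=> d0; have [zr|zr] := boolP (z \in r); last by rewrite (count_memPn zr).
move: d0; rewrite (perm_big _ (perm_to_rem zr)) big_cons /=.
rewrite (permP (perm_to_rem zr)) /= eqxx add1n ltnS leqn0.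
rewrite derivM derivXsubC mul1r hornerD hornerM hornerXsubC subrr mul0r addr0.
by rewrite -/(root _ z) root_prod_XsubC => /count_memPn/eqP.
Qed.

(** The derivative does not vanish on [mu], so no zero in the open right half-plane is repeated in
    [r]. *)
Lemma rhp_count (R : realType) (p : {poly R}) (mu : seq R) (r : seq R[i]) :
  rhp_roots p mu -> {in mu, forall x, p^`().[x] != 0} ->
  poly_toC p = \prod_(z <- r) ('X - z%:P) ->
  (count (fun z => 0 < complex.Re z)%R r <= size mu)%N.
Proof.
move=> [_ _ rp] d0 Ep; rewrite -size_filter -(size_map (real_complex R)).
have sub z : z \in r -> 0 < complex.Re z -> exists2 x, x \in mu & z = real_complex R x.
  by move=> zr z0; apply/(rp _ (ltW z0)); rewrite Ep root_prod_XsubC.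
apply: uniq_leq_size.
  apply: count_mem_uniq => z; have [|zf] := boolP (z \in _); last exact/count_memPn.
  move=> zf; apply/eqP; rewrite eqn_leq -has_count has_pred1 zf andbT.
  move: zf; rewrite mem_filter => /andP[z0 zr].
  apply: (@leq_trans (count_mem z r)).
    by rewrite count_filter sub_count // => x /andP[].
  apply: count_root_le1; rewrite -Ep /poly_toC deriv_map.
  by have [x xmu ->] := sub z zr z0; rewrite horner_map fmorph_eq0 d0.
move=> z; rewrite mem_filter => /andP[z0 zr].
by have [x xmu ->] := sub z zr z0; apply: map_f.
Qed.

(** The Christoffel-Darboux and Hermite expansions give one Gram matrix two sets of weights;
    [signature_bound] compares them, and unisolvence supplies its injectivity condition. *)
Lemma neg_prefix_prod_bound (R : realType) (b0 : R) (s : seq R) (mu : seq R) :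
  ~~ odd (size s) -> b0 != 0 -> (forall j, (j < size s)%N -> s`_j != 0) ->
  let p := (tail_pair s).1 + b0 *: (tail_pair s).2 in
  rhp_roots p mu -> {in mu, forall x, p^`().[x] != 0} ->
  ((size s).+1 <=
     #|[pred k : 'I_(size s).+1 | (0 < prefix_prod b0 s k)%R]| + size mu)%N.
Proof.
move=> es b00 s0 p rp d0.
have [mp szp] := tail_sum_monic b0 s; rewrite -/p in mp szp.
have [r Er] := closed_field_poly_normal (poly_toC p).
have {}Er : poly_toC p = \prod_(z <- r) ('X - z%:P).
  by rewrite Er (monicP (_ : poly_toC p \is monic)) ?scale1r // map_monic.
have szr : size r = (size s).+1.
  by apply: succn_inj; rewrite -(size_prod_XsubC r id) -Er size_map_poly.
pose c := real_complex R.
(* Distinct positive nodes, so that the factor [x_i + x_j] can be cancelled. *)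
pose x (i : 'I_(size s).+1) : R := i.+1%:R.
pose T k := (tail_pair (drop k s)).2.
pose t := \matrix_(i < (size s).+1, k < (size s).+1) c (T k).[x i].
pose a := \matrix_(i < (size s).+1, l < size r) (hermite_vec r (c (x i)))`_l.
pose beta (k : 'I_(size s).+1) := c (2 * prefix_prod b0 s k).
pose gamma (l : 'I_(size r)) := - (r`_l + (r`_l)^* ).
have cK y : (c y)^*  = c y by rewrite /c -[LHS]/(conjc _) conjc_real.
have cR y : c y \is Num.real by apply/CrealP.
have phorner y : \prod_(z <- r) (c y - z) = c p.[y].
  rewrite /c -horner_map -/(poly_toC p) Er horner_prod.
  by apply: eq_bigr => z _; rewrite hornerXsubC.
(* Conjugation fixes the value of the real polynomial [p]; the minus sign comes from the odd number
   of zeros. *)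
have preflect y : \prod_(z <- r) (c y + z^* ) = - c p.[- y].
  transitivity ((\prod_(z <- r) (-1 * (c (- y) - z)))^* ).
    rewrite rmorph_prod; apply: eq_bigr => z _.
    by rewrite mulN1r opprB /c rmorphN /= opprK addrC rmorphD /= -/c cK.
  rewrite big_split /= big_const_seq count_predT iter_mulr_1 szr phorner.
  by rewrite exprS -signr_odd (negPf es) expr0 mulr1 mulN1r rmorphN /= cK.
have eqG i j : \sum_k beta k * (t i k * (t j k)^* ) =
               \sum_k gamma k * (a i k * (a j k)^* ).
  have := hermite_vec_kernel r (c (x i)) (cR (x j)).
  rewrite !phorner !preflect cK rmorphN /= cK mulrNN -!rmorphM -rmorphB /=.
  rewrite tail_sum_kernel // => E.
  have N0 : c (x i) + c (x j) != 0.
    by rewrite -rmorphD fmorph_eq0 /x -natrD pnatr_eq0.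
  apply: (mulfI N0); transitivity (- (c (x i) + c (x j)) *
      \sum_(k < size r) (r`_k + (r`_k)^* ) * (a i k * (a j k)^* )); last first.
    by rewrite mulNr -mulrN -sumrN; congr (_ * _); apply: eq_bigr => k _; rewrite -mulNr.
  under [in RHS]eq_bigr => k _ do rewrite !mxE.
  rewrite -E [2 * _]mulrC -mulrA [in RHS]mulr_sumr rmorphM rmorphD rmorph_sum /=.
  congr (_ * _); apply: eq_bigr => k _.
  by rewrite !mxE cK /beta /c -!rmorphM -mulrA.
have bR k : beta k \is Num.real by apply: cR.
have gR k : gamma k \is Num.real.
  by rewrite /gamma rpredN; apply/CrealP; rewrite rmorphD /= conjCK addrC.
have inj_t (v : 'rV_(size s).+1) :
    (forall k, beta k != 0 -> (v *m t) 0 k = 0) -> v = 0.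
  move=> vt; apply/rowP => i; rewrite mxE.
  apply: (@tail_pair_unisolvent _ (map c s) _ (fun i => c (x i)) (v 0)).
  - move=> j k /real_complex_inj /eqP; rewrite eqr_nat eqSS => /eqP.
    exact: val_inj.
  - by rewrite size_map.
  move=> k; rewrite size_map => ks.
  have := vt (Ordinal ks); rewrite fmorph_eq0 mulf_neq0 ?pnatr_eq0 ?prefix_prod_neq0 //.
  move=> /(_ isT); rewrite mxE => {2}<-; apply: eq_bigr => j _; rewrite mxE.
  by rewrite -map_drop tail_pair_map /= horner_map.
have := signature_bound bR gR eqG inj_t; move/leq_trans; apply.
apply: leq_add.
  apply: subset_leq_card; apply/subsetP => k; rewrite !inE.
  by rewrite /beta -[0]/(c 0) ltcR pmulr_rgt0 // ltr0n.
(* [gamma] is negative exactly at the zeros with positive real part. *)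
apply: leq_trans (rhp_count rp d0 Er).
rewrite -sum1_count (big_nth 0) big_mkord -sum1_card.
rewrite leq_eqVlt; apply/orP; left; apply/eqP; apply: eq_bigl => l.
by rewrite inE /gamma oppr_lt0 gt0_addC.
Qed.

(** * Zeros of the odd part next to the positive zeros *)

(** Take any zero [a] and write [A = q * ('X - a)]. If [A'(a) = q(a)] is negative, then [q] changes
    sign on [(a, v)] and the induction applies to it; at its zero [c], [A'(c) = (c - a) q'(c)]. *)
Lemma upcrossing (R : rcfType) (A : {poly R}) (u v : R) :
  u < v -> A.[u] < 0 -> 0 < A.[v] ->
  exists a, [/\ u < a, a < v, root A a & 0 <= A^`().[a]].
Proof.
have [m] := ubnP (size A); elim: m A u => // m IH A u sA uv Au Av.
have AuAv : A.[u] * A.[v] < 0 by rewrite nmulr_rlt0.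
have [a] := poly_ivtoo (ltW uv) AuAv.
rewrite in_itv /= => /andP[ua av] ra; have /factor_theorem[q Eq] := ra.
have dA x : A^`().[x] = q.[x] + (x - a) * q^`().[x].
  rewrite Eq derivM derivXsubC mulr1 hornerD hornerM hornerXsubC; ring.
have [qa|qa] := lerP 0 q.[a].
  by exists a; rewrite dA subrr mul0r addr0.
have qv : 0 < q.[v].
  by move: Av; rewrite Eq hornerM hornerXsubC pmulr_lgt0 ?subr_gt0.
have sq : (size q < m)%N.
  have q0 : q != 0 by apply: contraTneq qa => ->; rewrite horner0 ltxx.
  by move: sA; rewrite Eq size_Mmonic ?monicXsubC // size_XsubC addn2.
have [c [ac cv rc dc]] := IH q a sq av qa qv.
exists c; rewrite (lt_trans ua ac) cv dA Eq rootM rc (eqP rc) add0r; split=> //.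
by rewrite mulr_ge0 // subr_ge0 ltW.
Qed.

Lemma crossing (R : rcfType) (A : {poly R}) (u v : R) :
  u < v -> A.[u] * A.[v] < 0 ->
  exists a, [/\ u < a, a < v, root A a & 0 <= A^`().[a] * A.[v]].
Proof.
move=> uv; have [Av|Av|->] := ltrgtP A.[v] 0; last by rewrite mulr0 ltxx.
  rewrite nmulr_llt0 // => Au.
  have [] := @upcrossing _ (- A) u v uv; rewrite ?hornerN ?oppr_lt0 ?oppr_gt0 //.
  move=> a [ua av]; rewrite rootN derivN hornerN => ra da; exists a.
  by split=> //; apply: mulr_le0; [rewrite -oppr_ge0 | apply: ltW].
rewrite pmulr_llt0 // => Au; have [a [ua av ra da]] := upcrossing uv Au Av.
by exists a; split=> //; rewrite mulr_ge0 // ltW.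
Qed.

(** Divide by ['X - x]: the quotient equals [p'(x)] at [x] and keeps its sign up to [a]. *)
Lemma deriv_sign_right (R : rcfType) (p : {poly R}) (x a : R) :
  x < a -> root p x -> p^`().[x] != 0 ->
  (forall y, x < y -> y <= a -> ~~ root p y) -> 0 < p^`().[x] * p.[a].
Proof.
move=> xa /factor_theorem[q ->] + nr.
rewrite derivM derivXsubC mulr1 hornerD hornerM hornerXsubC subrr mulr0 add0r => qx.
rewrite hornerM hornerXsubC mulrA pmulr_lgt0 ?subr_gt0 // ltNge; apply/negP => qq.
have [y] := polyrcf.poly_ivt (ltW xa) qq; rewrite in_itv /= => /andP[xy ya] ry.
have xy' : x < y.
  by rewrite lt_neqAle xy andbT; apply: contraNneq qx => ->.
by move: (nr y xy' ya); rewrite rootM ry.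
Qed.

Lemma deriv_sign_left (R : rcfType) (p : {poly R}) (x a : R) :
  a < x -> root p x -> p^`().[x] != 0 ->
  (forall y, a <= y -> y < x -> ~~ root p y) -> p^`().[x] * p.[a] < 0.
Proof.
move=> ax /factor_theorem[q ->] + nr.
rewrite derivM derivXsubC mulr1 hornerD hornerM hornerXsubC subrr mulr0 add0r => qx.
rewrite hornerM hornerXsubC mulrA nmulr_llt0 ?subr_lt0 // ltNge; apply/negP => qq.
rewrite mulrC in qq.
have [y] := polyrcf.poly_ivt (ltW ax) qq; rewrite in_itv /= => /andP[ay yx] ry.
have yx' : y < x.
  by rewrite lt_neqAle yx andbT; apply: contraNneq qx => <-.
by move: (nr y ay yx'); rewrite rootM ry.
Qed.

Lemma monic_large_gt0 (R : rcfType) (p : {poly R}) (v : R) :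
  p \is monic -> cauchy_bound p <= v -> 0 < p.[v].
Proof.
move=> mp pv; rewrite -sgr_cp0 (sgp_pinftyP (ge_cauchy_bound (monic_neq0 mp))).
  by rewrite /sgp_pinfty (monicP mp) sgr1.
by rewrite in_itv /= pv.
Qed.

Lemma odd_part_crossing (R : realType) (p A : {poly R}) (mu : seq R) (x : R) :
  p \is monic -> A \is monic ->
  (forall y, A.[y] = (p.[y] - p.[- y]) / 2) ->
  rhp_roots p mu -> {in mu, forall y, 0 < p^`().[y] * p.[- y]} ->
  x \in mu ->
  exists a, [/\ x < a, root A a, 0 <= A^`().[a] * p.[a]
              & forall y, x < y -> y <= a -> ~~ root p y].
Proof.
move=> mp mA EA rp S xmu; have [smu /allP mu0 _] := rp.
have rR y : 0 <= y -> root p y = (y \in mu) by apply: rhp_roots_real.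
have sq_gt0 (z : R) : z != 0 -> 0 < z ^+ 2 by move=> z0; rewrite exprn_even_gt0.
have x0 := mu0 x xmu; have rx : root p x by rewrite rR // ltW.
have d0 : {in mu, forall y, p^`().[y] != 0}.
  by move=> y /S; apply: contraTneq => ->; rewrite mul0r ltxx.
(* At a zero [y] of [p], [A(y) = - p(-y) / 2]. *)
have Ar y : y \in mu -> A.[y] * p^`().[y] < 0.
  move=> ymu; have /eqP py : root p y by rewrite rR ?(ltW (mu0 _ ymu)).
  rewrite EA py sub0r mulNr mulNr oppr_lt0 mulrAC pmulr_lgt0 ?invr_gt0 ?ltr0n //.
  by rewrite mulrC S.
(* Once [A(v)] has the sign of [p'(x)], [A] changes sign on [(x, v)], while [p] keeps the sign of
   [p'(x)] up to the crossing. *)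
suff [v [xv Av nr]] : exists v, [/\ x < v, 0 < p^`().[x] * A.[v]
    & forall y, x < y -> y < v -> ~~ root p y].
  have AA : A.[x] * A.[v] < 0.
    rewrite -(pmulr_llt0 _ (sq_gt0 _ (d0 x xmu))).
    rewrite expr2 mulrACA nmulr_rlt0 ?Ar // mulrC //.
  have [a [xa av ra da]] := crossing xv AA; exists a; split=> //; last first.
    by move=> y xy ya; apply: nr => //; apply: le_lt_trans av.
  have pa : 0 < p^`().[x] * p.[a].
    apply: deriv_sign_right => //; first exact: d0.
    by move=> y xy ya; apply: nr => //; apply: le_lt_trans av.
  have PA : 0 < (p^`().[x] * p.[a]) * (p^`().[x] * A.[v]) by rewrite mulr_gt0.
  have pAv : 0 < p.[a] * A.[v].
    by rewrite mulrACA -expr2 (pmulr_rgt0 _ (sq_gt0 _ (d0 x xmu))) in PA.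
  have Av0 : A.[v] != 0 by apply: contraTneq Av => ->; rewrite mulr0 ltxx.
  rewrite -(pmulr_lge0 _ (sq_gt0 _ Av0)).
  by rewrite expr2 mulrACA mulr_ge0 // ltW.
pose i := index x mu; have im : (i < size mu)%N by rewrite index_mem.
have ex : mu`_i = x by rewrite nth_index.
have [im'|im'] := ltnP i.+1 (size mu).
  (* At the next zero [y], [p'] has the opposite sign, as the midpoint shows, and
     [A(y) p'(y) < 0]. *)
  pose y := mu`_i.+1; have ymu : y \in mu by apply: mem_nth.
  have xy : x < y by rewrite -ex /y (lt_sorted_ltn_nth 0) ?inE.
  have nr z : x < z -> z < y -> ~~ root p z.
    move=> xz zy; rewrite rR ?(ltW (lt_trans x0 xz)) //; apply/negP => zmu.
    have zm : (index z mu < size mu)%N by rewrite index_mem.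
    move: xz zy; rewrite -(nth_index 0 zmu) -ex /y !(lt_sorted_ltn_nth 0) ?inE //.
    by rewrite ltnS => lt1 lt2; have := leq_trans lt1 lt2; rewrite ltnn.
  exists y; split=> //.
  pose m := (x + y) / 2; have [xm my] := (midf_lt xy : _ * _)%type.
  have d1 : 0 < p^`().[x] * p.[m].
    apply: deriv_sign_right => //; first exact: d0.
    by move=> z xz zm; apply: nr => //; apply: le_lt_trans my.
  have d2 : p^`().[y] * p.[m] < 0.
    apply: deriv_sign_left => //; [by rewrite rR ?(ltW (mu0 _ ymu)) | exact: d0 |].
    by move=> z mz zy; apply: nr => //; apply: lt_le_trans mz.
  have dxy : p^`().[x] * p^`().[y] < 0.
    have pm0 : p.[m] != 0 by apply: contraTneq d1 => ->; rewrite mulr0 ltxx.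
    rewrite -(pmulr_llt0 _ (sq_gt0 _ pm0)).
    by rewrite expr2 mulrACA pmulr_rlt0.
  rewrite -(pmulr_lgt0 _ (sq_gt0 _ (d0 y ymu))).
  by rewrite expr2 mulrACA nmulr_rgt0 // Ar.
(* Right of the last zero, beyond both Cauchy bounds, the monic [p] and [A] are positive. *)
pose v := Num.max (x + 1) (Num.max (cauchy_bound p) (cauchy_bound A)).
have xv : x < v by rewrite /v lt_max ltrDl ltr01.
have nr y : x < y -> ~~ root p y.
  move=> xy; rewrite rR ?(ltW (lt_trans x0 xy)) //; apply/negP => ymu.
  have ym : (index y mu < size mu)%N by rewrite index_mem.
  move: xy; rewrite -(nth_index 0 ymu) -ex (lt_sorted_ltn_nth 0) ?inE // => xy.
  by have := leq_trans xy (leq_trans ym im'); rewrite ltnn.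
have Av : 0 < A.[v] by apply: monic_large_gt0; rewrite // /v !le_max lexx !orbT.
have pv : 0 < p.[v] by apply: monic_large_gt0; rewrite // /v !le_max lexx !orbT.
exists v; split=> // [|y xy _]; last exact: nr.
have : 0 < p^`().[x] * p.[v] by apply: deriv_sign_right; rewrite ?d0 // => y xy _; apply: nr.
by rewrite (pmulr_lgt0 _ pv) => dx; rewrite mulr_gt0.
Qed.

(** * At least as many negative weights of odd index as positive zeros *)

(** The factor [x + y] of the kernel identity vanishes here, so the identity is taken over
    polynomials in the second variable and differentiated. *)
Lemma tail_pair_kernel_diag (R : idomainType) (s : seq R) (x : R) :
  (tail_pair s).1.[- x] = 0 ->
  (tail_pair s).2.[- x] * (tail_pair s).1^`().[x] =
  \sum_(k < (size s).+1) (\prod_(j < k) s`_j) *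
     ((tail_pair (drop k s)).2.[- x] * (tail_pair (drop k s)).2.[x]).
Proof.
move=> A0; have := tail_pair_kernel (map polyC s) (- x)%:P 'X.
rewrite tail_pair_map /= !horner_map /= A0 polyC0 mul0r add0r -!/(comp_poly _ _) !comp_polyXr.
move/(congr1 (fun q => q^`().[x])).
rewrite derivM derivC mul0r add0r hornerM hornerC => ->.
rewrite derivM derivD derivC derivX add0r mul1r hornerD hornerM.
rewrite hornerD hornerC hornerX addNr mul0r addr0 horner_sum size_map.
apply: eq_bigr => k _; rewrite -map_drop tail_pair_map /= horner_map /=.
rewrite -/(comp_poly _ _) comp_polyXr !hornerM !hornerC.
congr (_ * _); rewrite horner_prod; apply: eq_bigr => j _.
by rewrite (nth_map 0) ?hornerC // (leq_trans (ltn_ord j)) // -ltnS.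
Qed.

Lemma tail_sum_odd_part (R : realType) (b0 x : R) (s : seq R) :
  ~~ odd (size s) ->
  let p := (tail_pair s).1 + b0 *: (tail_pair s).2 in
  (tail_pair s).1.[x] = (p.[x] - p.[- x]) / 2.
Proof.
move=> es p; have [xA xB] := tail_pair_parity s x.
by rewrite /p !hornerD !hornerZ xA xB exprS -signr_odd (negPf es) expr0; field.
Qed.

(** At the zeros [a_i] of [A] given by [odd_part_crossing], the form with weights [- beta_k], [k]
    odd, is diagonal with entries [2 A'(a_i) p(a_i) >= 0]. By [signature_bound] at least [size mu]
    of these weights are positive. *)
Lemma odd_neg_prefix_prod_bound (R : realType) (b0 : R) (s : seq R)
    (mu : seq R) :
  ~~ odd (size s) -> b0 != 0 -> (forall j, (j < size s)%N -> s`_j != 0) ->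
  let p := (tail_pair s).1 + b0 *: (tail_pair s).2 in
  rhp_roots p mu -> {in mu, forall x, 0 < p^`().[x] * p.[- x]} ->
  (size mu < (size p)./2)%N /\
  (size mu <=
     #|[pred k : 'I_(size s).+1 | odd k && (prefix_prod b0 s k < 0)%R]|)%N.
Proof.
move=> es b00 s0 p rp S.
have [mp szp] := tail_sum_monic b0 s; rewrite -/p in mp szp.
have [szA mA _ _] := tail_pair_size_monic s.
pose A := (tail_pair s).1; pose B := (tail_pair s).2.
have [smu /allP mu0 _] := rp.
have exa (i : 'I_(size mu)) : exists a, [/\ mu`_i < a, root A a,
    0 <= A^`().[a] * p.[a] & forall y, mu`_i < y -> y <= a -> ~~ root p y].
  apply: (odd_part_crossing mp mA _ rp S (mem_nth 0 (ltn_ord i))) => y.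
  exact: tail_sum_odd_part.
have [a aP] := fin_all_exists exa.
have a0 i : 0 < a i.
  by have [lt_a _ _ _] := aP i; apply: lt_trans lt_a; apply/mu0/mem_nth.
have a_mono (i j : 'I_(size mu)) : (i < j)%N -> a i < a j.
  move=> ij; have [lt_j _ _ _] := aP j; apply: lt_trans lt_j.
  have [_ _ _ nr] := aP i; rewrite ltNge; apply/negP => mja.
  have mj : mu`_j \in mu by apply: mem_nth.
  have := nr mu`_j; rewrite (lt_sorted_ltn_nth 0) ?inE // => /(_ ij mja).
  by rewrite (rhp_roots_real rp) ?mj // ltW // mu0.
have a_inj : injective a.
  move=> i j eij; apply: val_inj; case: (ltngtP i j) => // /a_mono.
    by rewrite eij ltxx.
  by rewrite eij ltxx.
have Aa i : A.[a i] = 0 by have [_ /rootP] := aP i.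
have ANa i : A.[- a i] = 0 by rewrite (tail_pair_parity s (a i)).1 -/A Aa mulr0.
have pNa i : p.[- a i] = p.[a i].
  have := tail_sum_odd_part b0 (a i) es; rewrite -/A -/p Aa.
  by move/esym/eqP; rewrite mulf_eq0 invr_eq0 pnatr_eq0 orbF subr_eq0 => /eqP.
pose x (i : 'I_(size mu + size mu)) :=
  match split i with inl j => a j | inr j => - a j end.
have x_inj : injective x.
  move=> u v; rewrite -[u]splitK -[v]splitK /x !unsplitK.
  case: (split u) (split v) => i' [] j' /= e.
  - by rewrite (a_inj _ _ e).
  - by have := a0 i'; rewrite e oppr_gt0 ltNge ltW.
  - by have := a0 j'; rewrite -e oppr_gt0 ltNge ltW.
  by rewrite (a_inj _ _ (oppr_inj e)).
(* The odd polynomial [A] vanishes at 0 and at all [a_i] and [- a_i]; this bounds the number of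
   positive zeros. *)
have le_mu : ((size mu + size mu).+1 < size A)%N.
  have : uniq (0 :: [seq x i | i <- enum 'I_(size mu + size mu)]).
    rewrite /= (map_inj_uniq x_inj) enum_uniq andbT; apply/mapP => -[i _ e].
    move: e; rewrite /x; case: (split i) => j e.
      by have := a0 j; rewrite -e ltxx.
    by have := a0 j; rewrite -oppr_lt0 -e ltxx.
  move/(max_poly_roots (monic_neq0 mA)); rewrite /= size_map size_enum_ord; apply.
  apply/andP; split.
    have := (tail_pair_parity s 0).1; rewrite oppr0 exprS -signr_odd (negPf es) mulr1 mulN1r.
    by move/eqP; rewrite -subr_eq0 opprK -mulr2n mulrn_eq0.
  apply/allP => _ /mapP[i _ ->]; rewrite /root /x.
  by case: (split i) => j; rewrite -/A ?Aa ?ANa eqxx.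
split; first by move: le_mu; rewrite /A szA szp; lia.
pose c := real_complex R; pose n := (size s).+1.
pose T k := (tail_pair (drop k s)).2.
(* Twice the odd part of [T_k] at [a_i]; since [T_k] has the parity of [k], it is 0 for even [k]. *)
pose D i k : R := (T k).[a i] - (T k).[- a i].
pose beta (k : 'I_n) := if odd k then - prefix_prod b0 s k else 0.
have D0 i (k : 'I_n) : ~~ odd k -> D i k = 0.
  move=> ek; rewrite /D (tail_pair_parity _ (a i)).2 size_drop -signr_odd oddB.
    by rewrite (negPf es) (negPf ek) mul1r subrr.
  by rewrite -ltnS.
(* Off the diagonal all four kernel values vanish, because [p(- a_i) = p(a_i)]. For [i = j] the two
   at opposite points remain and are given by [tail_pair_kernel_diag]. *)
have DD i j : \sum_k beta k * (D i k * D j k) =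
              2 * (A^`().[a i] * p.[a i]) * (i == j)%:R.
  pose K y z := \sum_(k < n) prefix_prod b0 s k * ((T k).[y] * (T k).[z]).
  transitivity (- (K (a i) (a j) - K (- a i) (a j) - K (a i) (- a j) +
                   K (- a i) (- a j))).
    rewrite -sumrB -sumrB -big_split -sumrN; apply: eq_bigr => k _ /=.
    rewrite /beta; case: ifP => [_|/negbT ok]; first by rewrite /D; ring.
    move: (D0 i k ok) (D0 j k ok) => /eqP; rewrite subr_eq0 => /eqP -> /eqP.
    by rewrite subr_eq0 => /eqP ->; ring.
  have K0 y z : p.[y] * p.[z] = p.[- y] * p.[- z] -> y + z != 0 -> K y z = 0.
    move=> e yz; have /eqP := tail_sum_kernel b0 y z es.
    rewrite -/p e subrr eq_sym !mulf_eq0 pnatr_eq0 (negPf yz) /= => /eqP.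
    exact.
  rewrite (K0 (a i)) ?pNa //; last by rewrite gt_eqF ?addr_gt0.
  rewrite (K0 (- a i) (- a j)) ?opprK ?pNa //; last by rewrite -opprD oppr_eq0 gt_eqF ?addr_gt0.
  rewrite sub0r addr0.
  have [<-|ij] := eqVneq i j.
    have KC : K (a i) (- a i) = K (- a i) (a i).
      by apply: eq_bigr => k _; rewrite [(T k).[- _] * _]mulrC.
    rewrite KC; have -> : K (- a i) (a i) = A^`().[a i] * p.[a i].
      transitivity (b0 * (B.[- a i] * A^`().[a i])).
        rewrite tail_pair_kernel_diag ?ANa // mulr_sumr.
        by apply: eq_bigr => k _; rewrite [RHS]mulrA.
      by rewrite -pNa [p.[_]]hornerD hornerZ -/A -/B ANa add0r; ring.
    by rewrite mulr1; ring.
  rewrite (K0 (- a i) (a j)) ?opprK ?pNa //; last by rewrite addrC subr_eq0 eq_sym (inj_eq a_inj).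
  rewrite (K0 (a i) (- a j)) ?opprK ?pNa //; last by rewrite subr_eq0 (inj_eq a_inj).
  by rewrite mulr0 oppr0 addr0 oppr0.
have cK y : (c y)^*  = c y by rewrite /c -[LHS]/(conjc _) conjc_real.
have cR y : c y \is Num.real by apply/CrealP.
pose t := \matrix_(i < size mu, k < n) c (D i k).
pose gamma (i : 'I_(size mu)) := c (2 * (A^`().[a i] * p.[a i])).
have eqG i j : \sum_k c (beta k) * (t i k * (t j k)^* ) =
               \sum_k gamma k * ((1%:M : 'M_(size mu)) i k * ((1%:M : 'M_(size mu)) j k)^* ).
  rewrite (bigD1 i) //= [X in _ = _ + X]big1 ?addr0; last first.
    by move=> k ki; rewrite !mxE eq_sym (negPf ki) mul0r mulr0.
  rewrite !mxE eqxx mul1r eq_sym conjC_nat.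
  transitivity (c (\sum_k beta k * (D i k * D j k))).
    by rewrite /c rmorph_sum; apply: eq_bigr => k _; rewrite !mxE cK /c !rmorphM.
  by rewrite DD /gamma /c rmorphM rmorph_nat.
have inj_t (v : 'rV_(size mu)) :
    (forall k, c (beta k) != 0 -> (v *m t) 0 k = 0) -> v = 0.
  move=> vt; apply/rowP => i; rewrite mxE.
  (* Opposite weights at [a_j] and [- a_j] turn [v *m t] into a functional on the [T_k], so
     unisolvence applies. *)
  pose w (u : 'I_(size mu + size mu)) :=
    match split u with inl j => v 0 j | inr j => - v 0 j end.
  have := @tail_pair_unisolvent _ (map c s) _ (fun u => c (x u)) w _ _ _ (lshift _ i).
  rewrite /w (unsplitK (inl i)); apply.
  - by move=> u u' /real_complex_inj/x_inj.
  - by rewrite size_map; move: le_mu; rewrite /A szA !ltnS => /leqW.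
  move=> k; rewrite size_map => ks.
  transitivity ((v *m t) 0 (Ordinal ks)).
    rewrite mxE big_split_ord /= -big_split; apply: eq_bigr => j _ /=.
    rewrite /x (unsplitK (inl j)) (unsplitK (inr j)) !mxE -map_drop tail_pair_map /=.
    by rewrite !horner_map mulNr -mulrBr /D /c rmorphB.
  have [ok|ek] := boolP (odd k).
    apply: vt; rewrite fmorph_eq0 /beta /= ok oppr_eq0.
    exact: prefix_prod_neq0.
  rewrite mxE big1 // => j _; rewrite !mxE D0 // /c rmorph0 mulr0 //.
have := signature_bound (fun k => cR (beta k)) (fun k => cR _) eqG inj_t.
rewrite [X in (_ + X)%N]eq_card0 ?addn0; last first.
  move=> i; rewrite !inE /gamma -[0]/(c 0) ltcR; apply/negbTE; rewrite -leNgt.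
  by have [_ _ ge0 _] := aP i; rewrite mulr_ge0 ?ler0n.
move/leq_trans; apply; apply: subset_leq_card; apply/subsetP => k.
rewrite !inE -[0]/(c 0) ltcR /beta; case: ifP => _; last by rewrite ltxx.
by rewrite oppr_gt0.
Qed.

(** * The even kernel and sufficiency of the sign conditions *)

(** This is the half-sum of the Christoffel-Darboux kernel at [(x, y)] and [(x, - y)], cleared of
    denominators. The induction removes two entries at a time to keep parities. *)
Lemma tail_pair_even_kernel (R : comNzRingType) (s : seq R) (x y : R) :
  ~~ odd (size s) ->
  x * (tail_pair s).1.[x] * (tail_pair s).2.[y] -
  y * (tail_pair s).1.[y] * (tail_pair s).2.[x] =
  (x ^+ 2 - y ^+ 2) *
  \sum_(k < (size s).+1 | ~~ odd k) (\prod_(j < k) s`_j) *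
     ((tail_pair (drop k s)).2.[x] * (tail_pair (drop k s)).2.[y]).
Proof.
have [m] := ubnP (size s); elim: m s => // m IH [|c [|d s]] //= sm es.
  by rewrite big_mkcond big_ord1 big_ord0 /= !(hornerX, hornerC); ring.
rewrite negbK in es; rewrite big_mkcond big_ord_recl [X in _ = _ * (_ + X)]big_ord_recl big_ord0 /= add0r mul1r.
rewrite [RHS]mulrDr.
rewrite [X in _ = _ + _ * X](_ : _ = c * d *
   \sum_(k < (size s).+1 | ~~ odd k) (\prod_(j < k) s`_j) *
     ((tail_pair (drop k s)).2.[x] * (tail_pair (drop k s)).2.[y])); last first.
  rewrite [in RHS]big_mkcond mulr_sumr; apply: eq_bigr => k _ /=.
  rewrite /bump /= !add1n /= negbK; case: ifP => _; last by rewrite mulr0.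
  by rewrite !big_ord_recl /= !mulrA.
rewrite [X in _ = _ + X]mulrCA -(IH s) //; last exact: ltnW.
rewrite !(hornerD, hornerM, hornerX, hornerZ) /=; ring.
Qed.

(** Differentiate the preceding identity in [y] and put [y = x]. *)
Lemma tail_pair_even_kernel_diag (R : idomainType) (s : seq R) (x : R) :
  ~~ odd (size s) ->
  x * (tail_pair s).1.[x] * (tail_pair s).2^`().[x] -
  (tail_pair s).1.[x] * (tail_pair s).2.[x] -
  x * (tail_pair s).1^`().[x] * (tail_pair s).2.[x] =
  - (2 * x *
  \sum_(k < (size s).+1 | ~~ odd k) (\prod_(j < k) s`_j) *
     (tail_pair (drop k s)).2.[x] ^+ 2).
Proof.
move=> es; have := @tail_pair_even_kernel _ (map polyC s) x%:P 'X.
rewrite size_map => /(_ es).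
rewrite tail_pair_map /= !horner_map /= -!/(comp_poly _ _) !comp_polyXr.
move/(congr1 (fun q => q^`().[x])).
rewrite !derivB !derivM !derivC !derivX derivB derivXn -polyC_exp derivC.
rewrite !(hornerD, hornerN, hornerM, hornerX, hornerC, hornerXn, hornerMn, horner_sum).
rewrite -expr2 subrr [0 * _^`().[x]]mul0r addr0 => E.
apply: (etrans _ (etrans E _)); first by ring.
rewrite -mulNr; congr (_ * _); first by ring.
apply: eq_bigr => k _; rewrite -map_drop tail_pair_map /= horner_map /=.
rewrite -/(comp_poly _ _) comp_polyXr !hornerM hornerC -expr2.
congr (_ * _); rewrite horner_prod; apply: eq_bigr => j _.
by rewrite (nth_map 0) ?hornerC // (leq_trans (ltn_ord j)) // -ltnS.
Qed.

Lemma ge0_addC (R : rcfType) (z : R[i]) : (0 <= z + z^* ) = (0 <= complex.Re z).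
Proof.
case: z => a b; rewrite lecE /= subrr eqxx /=.
by rewrite -mulr2n pmulrn_lge0.
Qed.

Lemma conj_fixed (R : rcfType) (z : R[i]) :
  z^*  = z -> z = real_complex R (complex.Re z).
Proof. by case: z => a b [] /eqP; rewrite eqNr => /eqP ->. Qed.

(** The even kernel is evaluated on the diagonal at positive zeros, and at a conjugate pair for any
    zero with nonnegative real part. *)
Lemma rhp_roots_of_even_prefix_prods (R : realType) (b0 : R) (s : seq R) :
  ~~ odd (size s) -> b0 != 0 -> (forall j, (j < size s)%N -> s`_j != 0) ->
  (forall k, (k < (size s).+1)%N -> ~~ odd k -> 0 < prefix_prod b0 s k) ->
  let p := (tail_pair s).1 + b0 *: (tail_pair s).2 in
  exists mu, rhp_roots p mu /\ {in mu, forall x, 0 < p^`().[x] * p.[- x]}.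
Proof.
move=> es b00 s0 pos p.
have [mp szp] := tail_sum_monic b0 s; rewrite -/p in mp szp.
pose c := real_complex R.
(* The odd [A] vanishes at 0, so by coprimality [B] does not. *)
have p0 : ~~ root p 0.
  have [A0 _] := tail_pair_parity s 0.
  move/eqP: A0; rewrite oppr0 exprS -signr_odd (negPf es) mulr1 mulN1r.
  rewrite -subr_eq0 opprK -mulr2n mulrn_eq0 /= => A0.
  rewrite /root /p hornerD (eqP A0) add0r hornerZ mulf_neq0 //.
  exact: (tail_pair_coprime s0 A0).
pose mu := [seq x <- rootsR p | 0 < x]; exists mu.
have muE x : (x \in mu) = (0 < x) && root p x.
  by rewrite mem_filter mem_rootsR // monic_neq0.
split; last first.
  move=> x; rewrite muE => /andP[x0 rx].
  pose E := \sum_(k < (size s).+1 | ~~ odd k) prefix_prod b0 s k *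
     (tail_pair (drop k s)).2.[x] ^+ 2.
  have E0 : 0 <= E.
    by apply: sumr_ge0 => k ek; rewrite mulr_ge0 ?sqr_ge0 ?ltW ?pos.
  have EA : (tail_pair s).1.[x] = (p.[x] - p.[- x]) / 2 := tail_sum_odd_part b0 x es.
  rewrite (eqP rx) sub0r in EA.
  have D := tail_pair_even_kernel_diag x es.
  have bB : b0 * (tail_pair s).2.[x] = - (tail_pair s).1.[x].
    by apply/eqP; rewrite -addr_eq0 addrC -hornerZ -hornerD.
  (* Uses [b0 * B(x) = - A(x)]. The right side is negative, and [p(-x) = - 2 A(x)] turns this into
     the claim. *)
  have E1 : x * (tail_pair s).1.[x] * p^`().[x] =
      - (2 * x * E + (tail_pair s).1.[x] ^+ 2).
    have -> : 2 * x * E = b0 * (2 * x * \sum_(k < (size s).+1 | ~~ odd k)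
        (\prod_(j < k) s`_j) * (tail_pair (drop k s)).2.[x] ^+ 2).
      rewrite mulrCA /E; congr (_ * _); rewrite mulr_sumr.
      by apply: eq_bigr => k _; rewrite [RHS]mulrA.
    rewrite -[X in b0 * X]opprK -D /p derivD derivZ hornerD hornerZ.
    apply/eqP; rewrite -subr_eq0; apply/eqP.
    set A := (tail_pair s).1.[x] in bB *; set B := (tail_pair s).2.[x] in bB *.
    set dA := _^`().[x]; set dB := _^`().[x].
    transitivity ((A + x * dA) * (b0 * B + A)); first by ring.
    by rewrite bB addNr mulr0.
  have A0 : (tail_pair s).1.[x] != 0.
    apply/eqP => A0; move/eqP: bB; rewrite A0 oppr0 mulf_eq0 (negPf b00) /=.
    by apply/negP/(tail_pair_coprime s0)/rootP.
  have Np : p.[- x] = - (2 * (tail_pair s).1.[x]) by rewrite EA; field.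
  have : x * ((tail_pair s).1.[x] * p^`().[x]) < 0.
    rewrite mulrA E1 oppr_lt0 ltr_wpDl ?exprn_even_gt0 //.
    by rewrite mulr_ge0 // mulr_ge0 // ltW.
  rewrite pmulr_rlt0 // => Ap.
  by rewrite Np mulrN oppr_gt0 mulrCA pmulr_rlt0 ?ltr0n // mulrC.
split; first by apply: sorted_filter; [exact: lt_trans | exact: sorted_roots].
  exact: filter_all.
move=> z z0; split=> [rz|[x]]; last first.
  by rewrite muE => /andP[_ rx] ->; rewrite root_toC.
suff zr : z = c (complex.Re z).
  exists (complex.Re z) => //; rewrite muE lt_neqAle z0 andbT -root_toC -/c -zr rz andbT.
  by rewrite eq_sym; apply: contraNneq p0 => e; rewrite -root_toC -/c -e -zr.
pose sC := map c s; pose A := (tail_pair sC).1; pose B := (tail_pair sC).2.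
have sC0 j : (j < size sC)%N -> sC`_j != 0.
  by rewrite size_map => js; rewrite (nth_map 0) // fmorph_eq0 s0.
have EpC : poly_toC p = A + c b0 *: B.
  by rewrite /A /B tail_pair_map /p /poly_toC rmorphD /= map_polyZ.
have Az : A.[z] = - (c b0 * B.[z]).
  by apply/eqP; rewrite -addr_eq0 -hornerZ -hornerD -EpC.
have cK y : (c y)^*  = c y by rewrite /c -[LHS]/(conjc _) conjc_real.
have hornerJ (q : {poly R}) : (map_poly c q).[z^* ] = ((map_poly c q).[z])^* .
  rewrite -horner_map /= -map_poly_comp; congr horner.
  by apply: eq_map_poly => y /=; rewrite cK.
have AJ : A.[z^* ] = (A.[z])^*  by rewrite /A tail_pair_map hornerJ.
have BJ : B.[z^* ] = (B.[z])^*  by rewrite /B tail_pair_map hornerJ.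
pose E := \sum_(k < (size s).+1 | ~~ odd k) c (prefix_prod b0 s k) *
   ((tail_pair (drop k sC)).2.[z] * ((tail_pair (drop k sC)).2.[z])^* ).
have c_ge0 y : 0 <= y -> 0 <= c y by rewrite -[0 <= c y]/(c 0 <= c y) lecR.
have E0 : 0 <= E.
  by apply: sumr_ge0 => k ek; rewrite mulr_ge0 ?mul_conjC_ge0 ?c_ge0 // ltW ?pos.
(* The even kernel at [z] and its conjugate, with [A(z) = - b_0 B(z)]; the first factor vanishes
   exactly for real [z]. *)
have key : (z - z^* ) * ((z + z^* ) * E + c b0 ^+ 2 * (B.[z] * (B.[z])^* )) = 0.
  have := tail_pair_even_kernel z z^*  (_ : ~~ odd (size sC)).
  rewrite size_map => /(_ es).
  rewrite -/A -/B AJ BJ Az rmorphN rmorphM /= cK => H.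
  have EQ : E = c b0 * \sum_(k < (size s).+1 | ~~ odd k) (\prod_(j < k) sC`_j) *
      ((tail_pair (drop k sC)).2.[z] * (tail_pair (drop k sC)).2.[z^* ]).
    rewrite mulr_sumr; apply: eq_bigr => k _.
    rewrite mulrA /prefix_prod /c rmorphM rmorph_prod /= -/c; congr (_ * _ * _).
      apply: eq_bigr => j _; rewrite (nth_map 0) //.
      by rewrite (leq_trans (ltn_ord j)) // -ltnS.
    by rewrite -map_drop tail_pair_map /= hornerJ.
  set Q := \sum_(k < _ | _) _ in H EQ.
  transitivity (c b0 * ((z ^+ 2 - z^*  ^+ 2) * Q +
                (z - z^* ) * (c b0 * (B.[z] * (B.[z])^* )))).
    by rewrite EQ; ring.
  by rewrite -H; ring.
have zz : 0 <= z + z^* .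
  by rewrite ge0_addC.
have BB : 0 <= c b0 ^+ 2 * (B.[z] * (B.[z])^* ).
  by rewrite mulr_ge0 ?mul_conjC_ge0 // -rmorphXn /= c_ge0 ?sqr_ge0.
move/eqP: key; rewrite mulf_eq0 => /orP[|].
  by rewrite subr_eq0 eq_sym => /eqP/conj_fixed.
(* Both summands are nonnegative, so [B(z) = 0] and then [A(z) = 0], against coprimality. *)
rewrite (paddr_eq0 (mulr_ge0 zz E0) BB) => /andP[_].
rewrite mulf_eq0 expf_eq0 fmorph_eq0 (negPf b00) andbF /= mul_conjC_eq0 => /eqP B0.
have : root A z by rewrite /root Az B0 mulr0 oppr0.
by move/(tail_pair_coprime sC0); rewrite /root -/B B0 eqxx.
Qed.

(** * The signs of the weights and the order *)

(** At most [k] weights are negative, yet at least [k] of odd index are: both bounds are attained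
    and no weight of even index is negative. *)
Lemma prefix_signs_of_order (R : realType) (b0 : R) (s : seq R) (k : nat) :
  ~~ odd (size s) -> b0 != 0 -> (forall j, (j < size s)%N -> s`_j != 0) ->
  almost_gen_hurwitzI_order ((tail_pair s).1 + b0 *: (tail_pair s).2) k ->
  (forall j, (j < (size s).+1)%N -> ~~ odd j -> 0 < prefix_prod b0 s j) /\
  k = #|[pred j : 'I_(size s).+1 | odd j && (prefix_prod b0 s j < 0)%R]|.
Proof.
move=> es b00 s0; have [mp szp] := tail_sum_monic b0 s.
case/(almost_gen_hurwitzI_orderP k mp); first by rewrite szp /= negbK.
move=> _ [mu [<- rp S]].
have [_ le_odd] := odd_neg_prefix_prod_bound es b00 s0 rp S.
have d0 : {in mu, forall x, ((tail_pair s).1 + b0 *: (tail_pair s).2)^`().[x] != 0}.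
  by move=> x /S; apply: contraTneq => ->; rewrite mul0r ltxx.
have := neg_prefix_prod_bound es b00 s0 rp d0.
set P := [pred j | _] in le_odd *; set Q := [pred j | _].
pose N := [pred j : 'I_(size s).+1 | ~~ odd j && (prefix_prod b0 s j < 0)%R].
have : (#|Q| + (#|P| + #|N|) = (size s).+1)%N.
  rewrite -[in RHS](card_ord (size s).+1) -(cardC Q); congr (_ + _)%N.
  rewrite -(cardID [pred j : 'I_(size s).+1 | odd j] (predC Q)); congr (_ + _)%N; apply: eq_card => j.
    rewrite !inE -leNgt le_eqVlt (negPf (prefix_prod_neq0 _ _ _)) //=.
    by rewrite andbC.
  by rewrite !inE -leNgt le_eqVlt (negPf (prefix_prod_neq0 _ _ _)).
move=> eqn le_n; have N0 : #|N| = 0%N by lia.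
split; last by lia.
move=> j js ej; rewrite lt_neqAle eq_sym prefix_prod_neq0 //= leNgt; apply/negP => jlt.
by have := card0_eq N0 (Ordinal js); rewrite !inE /= ej jlt.
Qed.

Lemma almost_gen_hurwitzI_prefix (R : realType) (b0 : R) (s : seq R) :
  ~~ odd (size s) -> b0 != 0 -> (forall j, (j < size s)%N -> s`_j != 0) ->
  almost_gen_hurwitzI ((tail_pair s).1 + b0 *: (tail_pair s).2) <->
  (forall j, (j < (size s).+1)%N -> ~~ odd j -> 0 < prefix_prod b0 s j).
Proof.
move=> es b00 s0; split=> [[k /(prefix_signs_of_order es b00 s0)[]]//|pos].
have [mp szp] := tail_sum_monic b0 s.
have [mu [rp S]] := rhp_roots_of_even_prefix_prods es b00 s0 pos.
exists (size mu); apply/almost_gen_hurwitzI_orderP => //; first by rewrite szp /= negbK.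
have [ltmu _] := odd_neg_prefix_prod_bound es b00 s0 rp S.
by split=> //; exists mu.
Qed.

Lemma prefix_prod_nth (R : comNzRingType) (b : seq R) (k : nat) :
  prefix_prod b`_0 (behead b) k = \prod_(0 <= i < k.+1) b`_i.
Proof.
rewrite /prefix_prod big_mkord big_ord_recl; congr (_ * _).
by apply: eq_bigr => i _; rewrite nth_behead.
Qed.

(** Going from one weight of even index to the next multiplies it by one of the products
    [b_(2j-1) b_(2j)]. *)
Lemma pos_pairs_prefix (R : realType) (l : nat) (b : seq R) :
  (forall k, (k < (l.*2).+1)%N -> b`_k != 0) ->
  pos_pairs l b <->
  (forall j, (j < (l.*2).+1)%N -> ~~ odd j -> 0 < prefix_prod b`_0 (behead b) j).
Proof.
move=> b0; have step j :
    prefix_prod b`_0 (behead b) j.+1.*2 =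
    prefix_prod b`_0 (behead b) j.*2 * (b`_(j.+1.*2.-1) * b`_(j.+1.*2)).
  by rewrite !prefix_prod_nth !doubleS /= !big_nat_recr //= !mulrA.
split=> [[b00 bj] j|pos].
  move=> + ej; have -> : j = j./2.*2 by rewrite -[LHS]odd_double_half (negPf ej).
  rewrite ltnS leq_double; elim: (j./2) => [|i IH] il.
    by rewrite prefix_prod_nth big_nat1.
  by rewrite step mulr_gt0 ?IH ?bj // ltnW.
split; first by have := pos 0%N isT isT; rewrite prefix_prod_nth big_nat1.
case=> // j /= jl; have := pos j.+1.*2; rewrite ltnS leq_double odd_double.
move=> /(_ jl isT); rewrite step pmulr_rgt0 //.
by apply: pos; rewrite ?odd_double // ltnS leq_double ltnW.
Qed.

(** The product of the first [2i] entries is the weight of odd index [2i - 1]. *)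
Lemma num_neg_prods_card (R : realType) (l : nat) (b : seq R) :
  num_neg_prods l b =
  #|[pred j : 'I_(l.*2).+1 | odd j &&
       (prefix_prod b`_0 (behead b) j < 0)%R]|.
Proof.
rewrite -sum1_card /num_neg_prods.
rewrite -(big_mkord (fun j => odd j && (prefix_prod b`_0 (behead b) j < 0)) (fun=> 1%N)).
rewrite sum1_count /index_iota subn0.
elim: l => [|l IH]; first by [].
rewrite -[in LHS](addn1 l) iotaD count_cat IH doubleS.
rewrite -[in RHS](addn2 (l.*2).+1) iotaD count_cat; congr (_ + _)%N.
by rewrite add0n add1n /= odd_double /= prefix_prod_nth.
Qed.

(** * Hurwitz determinants and the Routh algorithm *)

(** The Hurwitz matrix, when [be] lists [a_1, a_3, ...] and [al] lists [a_0, a_2, ...]. Arbitrary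
    sequences keep the family closed under elimination. *)
Definition routh_mx (F : fieldType) (al be : nat -> F) (j : nat) : 'M[F]_j :=
  \matrix_(r, s) if (r./2 <= s)%N
                 then (if odd r then al else be) (s - r./2)%N else 0.

Lemma eq_routh_mx (F : fieldType) (al al' be be' : nat -> F) (j : nat) :
  al =1 al' -> be =1 be' -> routh_mx al be j = routh_mx al' be' j.
Proof.
by move=> ea eb; apply/matrixP => r s; rewrite !mxE; case: (odd r); rewrite ?ea ?eb.
Qed.

(* One step of the Routh algorithm: subtract from every odd row the multiple of
   the preceding row that clears its leading entry. *)
Lemma det_routh_rec (F : fieldType) (al be : nat -> F) (j : nat) :
  be 0%N != 0 ->
  \det (routh_mx al be j.+1) =
  be 0%N *
  \det (routh_mx be (fun i => al i.+1 - al 0%N / be 0%N * be i.+1) j).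
Proof.
move=> be0; pose q := al 0%N / be 0%N.
(* Left multiplication by the unipotent [U] performs the row operations. *)
pose U : 'M[F]_j.+1 :=
  \matrix_(r, k) ((r == k)%:R - q *+ (odd r && (k.+1 == r :> nat))).
have detU : \det U = 1.
  rewrite det_trig; first by rewrite big1 // => i _; rewrite mxE eqxx gtn_eqF ?andbF ?subr0.
  apply/is_trig_mxP => r k rk; rewrite mxE -val_eqE ltn_eqF // gtn_eqF ?andbF ?subr0 //.
  exact: ltnW.
have UE r s : (U *m routh_mx al be j.+1) r s =
    routh_mx al be j.+1 r s - (if odd r then q * routh_mx al be j.+1 (inord r.-1) s else 0).
  rewrite mxE; under eq_bigr => k _ do rewrite [U _ _]mxE mulrBl.
  rewrite sumrB (bigD1 r) //= eqxx mul1r big1 ?addr0; last first.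
    by move=> k kr; rewrite eq_sym (negPf kr) mul0r.
  congr (_ - _); case: ifP => [odr|_]; last by rewrite big1 // => k _; rewrite mul0r.
  have r0 : (0 < r)%N by case: (nat_of_ord r) odr.
  rewrite (bigD1 (inord r.-1)) //= inordK ?prednK ?eqxx //; last by rewrite ltnW.
  rewrite big1 ?addr0 // => k kr; case: eqP => [e|]; last by rewrite mul0r.
  case/eqP: kr; apply: val_inj; rewrite /= inordK -e //=.
rewrite -[LHS]mul1r -detU -det_mulmx (expand_det_col _ ord0) big_ord_recl big1 ?addr0.
  rewrite UE !mxE /= subr0 subn0 /cofactor /= addn0 expr0 mul1r; congr (_ * \det _).
  (* Deleting the first row swaps row parities: the cleared odd rows become the even rows of the
     smaller matrix. *)
  apply/matrixP => r s; rewrite [LHS]mxE [LHS]mxE UE !mxE /= /bump !leq0n !add1n /=.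
  rewrite inordK; last by rewrite ltnW // ltnS ltn_ord.
  case: (boolP (odd r)) => [odr|evr] /=.
    rewrite subr0; have -> : uphalf r = r./2.+1 by rewrite uphalf_half odr.
    by rewrite ltnS subSS.
  have -> : uphalf r = r./2 by rewrite uphalf_half (negPf evr).
  case: (ltngtP r./2 s.+1) => [lt|lt|e].
  - by rewrite -ltnS lt subSn.
  - by rewrite leqNgt -ltnS ltnW // mulr0 subrr.
  by rewrite e subnn leqNgt ltnSn /q divfK // subrr.
move=> i _; rewrite UE !mxE /= ?add0n.
rewrite inordK; last by rewrite ltnW // ltnS ltn_ord.
case: i => i ij /=; case: (boolP (odd i)) => [odr|evr] /=.
  by rewrite leqn0 uphalf_half odr /= subrr mul0r.
rewrite !leqn0 uphalf_half (negPf evr) add0n sub0n.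
by case: eqP => _; rewrite ?mulr0 ?subrr ?mul0r // /q divfK // subrr mul0r.
Qed.

(** The guard is needed because truncated subtraction would return the constant term beyond the
    end. *)
Definition step2_coef (F : fieldType) (q : {poly F}) (m i : nat) : F :=
  if (i.*2 <= m)%N then q`_(m - i.*2) else 0.

Lemma routh_tail_pair (F : fieldType) (m : nat) (A B : {poly F}) (a c : F) :
  A \is monic -> size A = m.+2 -> B \is monic -> size B = m.+1 ->
  (forall i, ~~ odd (i + m) -> A`_i = 0) ->
  (forall i, odd (i + m) -> B`_i = 0) ->
  a != 0 -> c != 0 ->
  (forall j, (1 <= j <= m.+1)%N ->
     \det (routh_mx (fun i => a * step2_coef A m.+1 i)
                    (fun i => c * step2_coef B m i) j) != 0) ->
  exists s, [/\ size s = m, forall j, (j < size s)%N -> s`_j != 0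
              & tail_pair s = (A, B)].
Proof.
elim: m A B a c => [|m IH] A B a c mA sA mB sB pA pB a0 c0 dets.
  exists [::]; split=> //=.
  have -> : B = 1.
    rewrite [B]size1_polyC ?sB //; have /monicP := mB; rewrite lead_coefE sB.
    by move=> ->.
  congr (_, _); apply/polyP => i; rewrite coefX.
  case: i => [|[|i]]; first by rewrite pA.
    by have /monicP := mA; rewrite lead_coefE sA.
  by rewrite nth_default // sA.
have B1 : B`_m.+1 = 1 by have /monicP := mB; rewrite lead_coefE sB.
have A1 : A`_m.+2 = 1 by have /monicP := mA; rewrite lead_coefE sA.
pose D := A - 'X * B; pose g := D`_m.
have DE i : D`_i = A`_i - (if i is i'.+1 then B`_i' else 0).
  by rewrite coefB coefXM; case: i.
have sD : (size D <= m.+1)%N.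
  apply/leq_sizeP => i; rewrite DE; case: i => // i.
  rewrite ltnS leq_eqVlt => /orP[/eqP <-|].
    by rewrite pA ?pB ?subrr //; [rewrite addnS /= oddD addbb | rewrite addnn odd_double].
  rewrite leq_eqVlt => /orP[/eqP <-|mi]; first by rewrite A1 B1 subrr.
  by rewrite !nth_default ?subrr ?sA ?sB.
have pD i : odd (i + m) -> D`_i = 0.
  move=> im; rewrite DE pA; last by rewrite addnS /= im.
  by case: i im => [|i] im; rewrite ?subrr // pB ?subrr // addnS -addSn.
pose ga i := a * step2_coef A m.+2 i.+1 -
   (a * step2_coef A m.+2 0) / (c * step2_coef B m.+1 0) *
   (c * step2_coef B m.+1 i.+1).
have gaE : ga =1 (fun i => a * step2_coef D m i).
  move=> i; rewrite /ga /step2_coef !double0 !subn0 /= A1 B1 !mulr1 doubleS !ltnS.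
  rewrite !subSS mulrA divfK //.
  case: (leqP i.*2 m) => [im|im]; last by rewrite [(i.*2 < m)%N]ltnNge (ltnW im) !mulr0 subrr.
  rewrite DE -mulrBr; congr (_ * (_ - _)).
  by case: ltnP => lim; [rewrite -(subnSK lim) | rewrite (eqP lim : m - i.*2 = 0)%N].
have be0 : c * step2_coef B m.+1 0 = c by rewrite /step2_coef subn0 B1 mulr1.
have rec j : \det (routh_mx (fun i => a * step2_coef A m.+2 i)
                    (fun i => c * step2_coef B m.+1 i) j.+1) =
    c * \det (routh_mx (fun i => c * step2_coef B m.+1 i)
                       (fun i => a * step2_coef D m i) j).
  rewrite det_routh_rec be0 //; congr (_ * \det _).
  by apply: eq_routh_mx => // i; rewrite -gaE /ga be0.
(* The determinant of order 2 is [c * (a * g)]. *)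
have g0 : g != 0.
  have := dets 2 isT; rewrite rec det_mx11 mxE /= /step2_coef double0 subn0 /=.
  by rewrite !mulf_eq0 !negb_or => /andP[_ /andP[]].
have Dg : D = g *: (g^-1 *: D) by rewrite scalerA divff // scale1r.
have sD' : size (g^-1 *: D) = m.+1.
  rewrite size_scale ?invr_eq0 //; apply/eqP; rewrite eqn_leq sD /= ltnNge.
  by apply: contraNN g0 => sDm; rewrite /g nth_default.
have [s [ss s0 es]] : exists s, [/\ size s = m,
    forall j, (j < size s)%N -> s`_j != 0 & tail_pair s = (B, g^-1 *: D)].
  apply: (IH _ _ c (a * g)) => //.
  - by rewrite monicE lead_coefE sD' coefZ mulVf.
  - by move=> i; rewrite -[X in ~~ X]negbK => im; apply: pB; move: im; rewrite addnS /= negbK.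
  - by move=> i im; rewrite coefZ pD // mulr0.
  - by rewrite mulf_neq0.
  move=> j /andP[j1 jm]; have := dets j.+1 jm; rewrite rec mulf_eq0 negb_or => /andP[_].
  rewrite (eq_routh_mx (al' := fun i => c * step2_coef B m.+1 i)
    (be' := fun i => a * g * step2_coef (g^-1 *: D) m i)) // => i.
  by rewrite /step2_coef; case: ifP; rewrite ?mulr0 // coefZ [RHS]mulrA mulfK.
exists (g :: s); split; first by rewrite /= ss.
  by case.
by rewrite /= es /= -Dg /D addrC subrK.
Qed.

(** With indices from 0 the entry is [a_(2s+1-r)], whose index is negative exactly when
    [s < r./2]. *)
Lemma hurwitz_det_routh (R : realType) (p : {poly R}) (m j : nat) :
  size p = m.+2 ->
  hurwitz_det p j = \det (routh_mx (step2_coef p m.+1) (step2_coef p m) j).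
Proof.
move=> sp; congr (\det _); apply/matrixP => r s; rewrite !mxE.
have er := odd_double_half r; case: ifP => rs.
  have -> : s.+1.*2%:Z - r.+1%:Z = (s.*2.+1 - r)%N%:Z :> int by lia.
  rewrite /acoef sp /= /step2_coef; case: (odd r) er => er /=.
    by have -> : (s.*2.+1 - r = (s - r./2).*2)%N by lia.
  have -> : (s.*2.+1 - r = (s - r./2).*2.+1)%N by lia.
  by rewrite ltnS subSS.
have -> : s.+1.*2%:Z - r.+1%:Z = Negz (r - s.*2.+1).-1 :> int by lia.
by [].
Qed.

(** [A] takes the coefficients whose index has the parity of the degree, [b0 B] the others. The
    leading one of these, [b0 = a_1], is the first Hurwitz determinant, hence nonzero. *)
Lemma tail_sum_of_hurwitz_det (R : realType) (m : nat) (p : {poly R}) :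
  p \is monic -> size p = m.+2 ->
  (forall j, (1 <= j <= m.+1)%N -> hurwitz_det p j != 0) ->
  exists b0 s, [/\ size s = m, b0 != 0, forall j, (j < size s)%N -> s`_j != 0
                 & p = (tail_pair s).1 + b0 *: (tail_pair s).2].
Proof.
move=> mp sp dets; pose b0 := p`_m.
have p1 : p`_m.+1 = 1 by have /monicP := mp; rewrite lead_coefE sp.
have b00 : b0 != 0.
  have := dets 1%N isT; rewrite (hurwitz_det_routh _ sp) det_mx11 mxE /= /step2_coef.
  by rewrite double0 subn0.
pose A := \poly_(i < m.+2) (if odd (i + m) then p`_i else 0).
pose B := \poly_(i < m.+1) (if odd (i + m) then 0 else p`_i / b0).
have sA : size A = m.+2.
  by rewrite size_poly_eq //= addnn odd_double p1 oner_eq0.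
have sB : size B = m.+1.
  by rewrite size_poly_eq //= addnn odd_double divff ?oner_eq0.
have [s [ss s0 es]] : exists s, [/\ size s = m,
    forall j, (j < size s)%N -> s`_j != 0 & tail_pair s = (A, B)].
  apply: (@routh_tail_pair _ m A B 1 b0) => //.
  - by rewrite monicE lead_coefE sA coef_poly ltnSn /= addnn odd_double p1.
  - by rewrite monicE lead_coefE sB coef_poly ltnSn /= addnn odd_double divff.
  - by move=> i /negPf im; rewrite coef_poly im if_same.
  - by move=> i im; rewrite coef_poly im if_same.
  - exact: oner_neq0.
  move=> j /dets; rewrite (hurwitz_det_routh _ sp).
  rewrite (eq_routh_mx (al' := fun i => 1 * step2_coef A m.+1 i)
    (be' := fun i => b0 * step2_coef B m i)) // => i; rewrite /step2_coef; case: ifP => im.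
  - rewrite mul1r coef_poly ltnS leq_subr; case: ifP => // /negP[]; lia.
  - by rewrite mulr0.
  - rewrite coef_poly ltnS leq_subr; case: ifP => [|_]; first by lia.
    by rewrite mulrC divfK.
  - by rewrite mulr0.
exists b0, s; split=> //; rewrite es /=; apply/polyP => i.
rewrite coefD coefZ !coef_poly; case: (ltnP i m.+2) => im.
  case: ifP => oim; first by rewrite if_same mulr0 addr0.
  have -> : (i < m.+1)%N by rewrite ltn_neqAle -ltnS im andbT; apply: contraFneq oim => ->; rewrite addSn /= addnn odd_double.
  by rewrite add0r mulrC divfK.
rewrite [(i < m.+1)%N]ltnNge (ltnW im) /= mulr0 addr0 nth_default // sp //.
Qed.

(** * Uniqueness and spectra *)

Lemma tail_pair_coef0 (R : comNzRingType) (s : seq R) (i : nat) :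
  (~~ odd (i + size s) -> (tail_pair s).1`_i = 0) /\
  (odd (i + size s) -> (tail_pair s).2`_i = 0).
Proof.
elim: s i => [|c s IH] i /=.
  by rewrite addn0 coefX coef1; case: i => [|[|i]].
rewrite coefD coefXM coefZ addnS /= negbK; split; last exact: (IH i).1.
move=> im; rewrite (IH i).2 // mulr0 addr0; case: i im => // i im.
by rewrite (IH i).1.
Qed.

(** [A] and [b0 B] occupy coefficients of opposite parity, so the sum determines both, and [b0] is
    the leading coefficient of the second. *)
Lemma tail_sum_inj (R : idomainType) (b0 c0 : R) (s t : seq R) :
  b0 != 0 -> (forall j, (j < size s)%N -> s`_j != 0) -> size s = size t ->
  (tail_pair s).1 + b0 *: (tail_pair s).2 =
  (tail_pair t).1 + c0 *: (tail_pair t).2 -> b0 = c0 /\ s = t.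
Proof.
move=> b00 s0 est e.
have ci i := congr1 (fun q : {poly R} => q`_i) e.
have eA : (tail_pair s).1 = (tail_pair t).1.
  apply/polyP => i; have [ie|io] := boolP (odd (i + size s)); last first.
    by rewrite !(tail_pair_coef0 _ _).1 // -est.
  have := ci i; rewrite !coefD !coefZ !(tail_pair_coef0 _ _).2 // -?est //.
  by rewrite !mulr0 !addr0.
move: e; rewrite eA => /addrI eB.
have [_ _ _ mBs] := tail_pair_size_monic s.
have [_ _ _ mBt] := tail_pair_size_monic t.
have ebc : b0 = c0.
  have := congr1 lead_coef eB.
  by rewrite !lead_coefZ (monicP mBs) (monicP mBt) !mulr1.
split=> //; apply: tail_pair_inj => //.
rewrite [LHS]surjective_pairing [RHS]surjective_pairing eA; congr pair.
apply: (@mulfI _ b0%:P); first by rewrite polyC_eq0.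
by rewrite !mul_polyC eB ebc.
Qed.

Lemma mu_prod_XsubC (F : idomainType) (r : seq F) (z : F) :
  \mu_z (\prod_(x <- r) ('X - x%:P)) = count_mem z r.
Proof.
elim: r => [|x r IH]; first by rewrite big_nil muNroot // root1.
have r0 : \prod_(y <- r) ('X - y%:P) != 0 by rewrite monic_neq0 ?monic_prod_XsubC.
rewrite big_cons mu_mul ?mulf_neq0 ?polyXsubC_eq0 // IH /=; congr (_ + _)%N.
by have [->|xz] := eqVneq x z; rewrite ?mu_XsubC // muNroot // root_XsubC eq_sym.
Qed.

(** The characteristic polynomial splits over the complex numbers, and multiplicities fix the list
    of its zeros up to order. *)
Lemma has_spectrum_char_poly (R : realType) (n : nat) (A : 'M[R]_n)
    (lam : seq R[i]) :
  has_spectrum A lam <->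
  poly_toC (char_poly A) = \prod_(z <- lam) ('X - z%:P).
Proof.
have eA : char_poly (map_mx (real_complex R) A) = poly_toC (char_poly A).
  by rewrite /poly_toC map_char_poly.
split=> [sp|e z]; last by rewrite eA e mu_prod_XsubC.
have [r] := closed_field_poly_normal (poly_toC (char_poly A)).
rewrite (monicP (_ : poly_toC _ \is monic)); last by rewrite map_monic char_poly_monic.
rewrite scale1r => Er; rewrite Er; apply: perm_big; apply/allP => z _ /=.
by rewrite -sp eA Er mu_prod_XsubC.
Qed.

Theorem theorem5p4 (R : realType) (l n : nat) (hn : n = (2 * l + 1)%N) :
  (forall b : n.-tuple R,
     (forall k, (k < n)%N -> b`_k != 0) ->
     (almost_gen_hurwitzI (char_poly (schwarz_mx b)) <-> pos_pairs l b) /\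
     (forall kappa,
        almost_gen_hurwitzI_order (char_poly (schwarz_mx b)) kappa ->
        kappa = num_neg_prods l b))
  /\
  (forall (lam : n.-tuple R[i]) (p : {poly R}) (kappa : nat),
     poly_toC p = \prod_(z <- lam) ('X - z%:P) ->
     almost_gen_hurwitzI_order p kappa ->
     (forall j, (1 <= j <= n)%N -> hurwitz_det p j != 0) ->
     exists! J : 'M[R]_n,
       exists b : n.-tuple R,
         [/\ J = schwarz_mx b,
             forall k, (k < n)%N -> b`_k != 0,
             pos_pairs l b,
             num_neg_prods l b = kappa
           & has_spectrum J lam]).
Proof.
have en : n = (l.*2).+1 by lia.
clear hn; subst n.
have tl (b : (l.*2).+1.-tuple R) : size (behead b) = l.*2.
  by rewrite size_behead size_tuple.
have tl0 (b : (l.*2).+1.-tuple R) :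
    (forall k, (k < (l.*2).+1)%N -> b`_k != 0) ->
    forall j, (j < size (behead b))%N -> (behead b)`_j != 0.
  by move=> b0 j; rewrite tl nth_behead => jl; apply: b0.
have ev (b : (l.*2).+1.-tuple R) : ~~ odd (size (behead b)) by rewrite tl odd_double.
(* Stated apart because the inverse problem also draws the sign conditions and the order from it. *)
have direct (b : (l.*2).+1.-tuple R) :
    (forall k, (k < (l.*2).+1)%N -> b`_k != 0) ->
    (almost_gen_hurwitzI (char_poly (schwarz_mx b)) <-> pos_pairs l b) /\
    (forall kappa,
       almost_gen_hurwitzI_order (char_poly (schwarz_mx b)) kappa ->
       kappa = num_neg_prods l b).
  move=> b0; rewrite char_poly_schwarz num_neg_prods_card; split.
    have G := almost_gen_hurwitzI_prefix (ev b) (b0 0%N isT) (tl0 b b0).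
    have P := pos_pairs_prefix b0; rewrite tl in G.
    by split=> [/G/P|/P/G].
  move=> kappa /(prefix_signs_of_order (ev b) (b0 0%N isT) (tl0 b b0))[_].
  by rewrite tl.
split=> // lam p kappa Ep ord dets.
have mp : p \is monic.
  by rewrite -(map_monic (real_complex R)) -/(poly_toC p) Ep monic_prod_XsubC.
have sp : size p = (l.*2).+2.
  by rewrite -(size_map_poly (real_complex R)) -/(poly_toC p) Ep size_prod_XsubC size_tuple.
have [b0 [s [ss b00 s0 pE]]] := tail_sum_of_hurwitz_det mp sp dets.
have sb : size (b0 :: s) == (l.*2).+1 by rewrite /= ss.
pose b := Tuple sb.
have bn0 k : (k < (l.*2).+1)%N -> b`_k != 0.
  by case: k => [|k] //= kl; apply: s0; rewrite ss.
have cb : char_poly (schwarz_mx b) = p by rewrite char_poly_schwarz pE.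
have [agh num] := direct b bn0; rewrite cb in agh num.
exists (schwarz_mx b); split.
  exists b; split=> //; first by apply/agh; exists kappa.
    exact/esym/num.
  by apply/has_spectrum_char_poly; rewrite cb.
(* The spectrum fixes the characteristic polynomial [p], from which [tail_sum_inj] recovers the
   entries. *)
move=> J [b' [-> b'0 _ _ /has_spectrum_char_poly]]; rewrite -Ep.
move/(map_inj_poly (@real_complex_inj R) (rmorph0 _)); rewrite char_poly_schwarz pE => e.
congr schwarz_mx; apply: val_inj => /=.
have [] := tail_sum_inj b00 s0 _ (esym e); first by rewrite tl.
by case: (tupleP b') => x t /= -> ->.
Qed.
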